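(* Let $X$ and $Y$ be connected CW complexes and let $f\colon X\to Y$ be a map which induces an isomorphism of fundamental groups. Then for each integer $m\ge2$, $$\mathrm{dTC}^{\mathcal D}_m(X)\le\mathrm{dTC}^{\mathcal D}_m(Y).$$
   Context: All spaces are connected CW complexes and maps are continuous. For a space $Z$ and an integer $n\ge 1$, let $\mathcal B_n(Z)$ be the set of probability measures on $Z$ supported on at most $n$ points, i.e. formal sums $\sum_{i=1}^n a_i z_i$ with $z_i\in Z$, $a_i\ge 0$, $\sum a_i=1$ (a point $z$ standing for the Dirac measure $\delta_z$). It carries the topology of weak convergence of measures; for metric $Z$ this is the topology of the Lévy–Prokhorov metric. For a map $f\colon E\to B$ put $E_n=\{\mu\in\mathcal B_n(E)\mid \mathrm{supp}(\mu)\subset f^{-1}(b)\text{ for some } b\in B\}$, a subspace of $\mathcal B_n(E)$, and let $f_n\colon E_n\to B$ send $\mu$ to that $b$. If $f$ is a fibration, then so is $f_n$. The distributional sectional category $\mathrm{dsecat}(f)$ of a fibration $f$ is the least integer $n\ge0$ such that $f_{n+1}$ has a section ($\infty$ if none exists). Let $\pi=\pi_1(X)$ and let $\widetilde X$ be the universal cover of $X$. For $m\ge2$, $\widetilde X^m_\pi$ denotes the orbit space of $\widetilde X^m$ under the diagonal action of $\pi$, and $r^X_m\colon\widetilde X^m_\pi\to X^m$ is the induced covering map (corresponding to the diagonal subgroup of $\pi^m$). The $m$-th sequential diagonal distributional complexity is $\mathrm{dTC}^{\mathcal D}_m(X)=\mathrm{dsecat}(r^X_m)$. *)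

(* Defs.v *)
From HB Require Import structures.
From mathcomp Require Import all_boot all_order all_algebra generic_quotient.
From mathcomp Require Import all_classical all_reals topology normedtype.
From mathcomp Require Import homotopy ring lra.

Set Implicit Arguments.
Unset Strict Implicit.
Unset Printing Implicit Defensive.

Import Order.TTheory GRing.Theory Num.Theory numFieldNormedType.Exports.

Local Open Scope classical_set_scope.
Local Open Scope ring_scope.
Local Open Scope quotient_scope.
Local Open Scope card_scope.

Definition unit_interval (R : realType) : Type := set_type (`[0, 1]%classic : set R).

Section UnitInterval.
Context {R : realType}.
Local Notation I := (unit_interval R).

HB.instance Definition _ :=
  Topological.copy I (set_type (`[0, 1]%classic : set R)).

Definition ival (s : I) : R := \val s.
Arguments ival : simpl never.

Definition clamp_val (t : R) : R := Num.max 0 (Num.min t 1).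

Fact clamp_subproof (t : R) : clamp_val t \in (`[0, 1]%classic : set R).
Proof.
rewrite /clamp_val inE /= in_itv/= le_max lexx/= ge_max ler01/=.
by rewrite ge_min lexx orbT.
Qed.

(* The retraction of the real line onto [0, 1]. *)
Definition clamp (t : R) : I := exist _ (clamp_val t) (clamp_subproof t).

Lemma clamp_val_le0 (t : R) : t <= 0 -> clamp_val t = 0.
Proof. by move=> t0; rewrite /clamp_val min_l ?max_l//; lra. Qed.

Lemma clamp_val_ge1 (t : R) : 1 <= t -> clamp_val t = 1.
Proof. by move=> t1; rewrite /clamp_val min_r ?max_r//; lra. Qed.

Lemma clamp_val_id (t : R) : 0 <= t <= 1 -> clamp_val t = t.
Proof. by move=> /andP[? ?]; rewrite /clamp_val min_l ?max_r//. Qed.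

Fact zero_neq_one : clamp 0 != clamp 1.
Proof.
apply/eqP => /(congr1 ival); rewrite /ival /= clamp_val_le0// clamp_val_ge1//.
by move/eqP; rewrite eq_sym oner_eq0.
Qed.

HB.instance Definition _ := isBiPointed.Build I zero_neq_one.

Lemma unit_interval_bounds (s : I) : 0 <= ival s <= 1.
Proof. by have := set_valP s; rewrite /= in_itv. Qed.

Lemma clampK (s : I) : clamp (ival s) = s.
Proof. by apply: val_inj; rewrite /= clamp_val_id// unit_interval_bounds. Qed.

Lemma ival_clamp (t : R) : 0 <= t <= 1 -> ival (clamp t) = t.
Proof. exact: clamp_val_id. Qed.

Lemma clamp_le0 (t : R) : t <= 0 -> clamp t = zero.
Proof. by move=> t0; apply: val_inj; rewrite /= !clamp_val_le0. Qed.

Lemma clamp_ge1 (t : R) : 1 <= t -> clamp t = one.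
Proof. by move=> t1; apply: val_inj; rewrite /= !clamp_val_ge1. Qed.

Lemma ival_zero : ival (zero : I) = 0.
Proof. by rewrite /ival /= clamp_val_le0. Qed.

Lemma ival_one : ival (one : I) = 1.
Proof. by rewrite /ival /= clamp_val_ge1. Qed.

Lemma ival_continuous : continuous ival.
Proof. exact: initial_continuous. Qed.

Lemma clamp_continuous : continuous clamp.
Proof.
have cv : continuous clamp_val.
  move=> t; apply: (@continuous_max _ _ (cst 0) (fun u : R => Num.min u 1)).
    exact: cst_continuous.
  apply: (@continuous_min _ _ id (cst 1)); first exact: cvg_id.
  exact: cst_continuous.
exact: (@continuous_comp_initial _ _ _ set_val clamp cv).
Qed.

End UnitInterval.

Arguments unit_interval : clear implicits.

Lemma glue_continuous {R : realType} {S T : topologicalType} (h : S -> R)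
    (f g : S -> T) (c : R) :
  continuous h -> continuous f -> continuous g ->
  (forall s, h s = c -> f s = g s) ->
  continuous (fun s => if h s <= c then f s else g s).
Proof.
move=> ch cf cg fg s A /= nA.
suff : \forall t \near s, A (if h t <= c then f t else g t) by [].
have [hsc|hsc|hsc] := ltgtP (h s) c.
- rewrite ifT in nA; last exact: ltW.
  have n1 : \forall t \near s, h t < c := ch _ _ (lt_nbhsl hsc).
  have n2 : \forall t \near s, A (f t) := cf _ _ nA.
  near=> t; rewrite ifT; last by apply/ltW; near: t.
  by near: t.
- rewrite ifF in nA; last by apply/negbTE; rewrite -ltNge.
  have n1 : \forall t \near s, c < h t := ch _ _ (lt_nbhsr hsc).
  have n2 : \forall t \near s, A (g t) := cg _ _ nA.
  near=> t; rewrite ifF; first by near: t.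
  by apply/negbTE; rewrite -ltNge; near: t.
- rewrite hsc lexx in nA; have nA' := nA; rewrite fg// in nA'.
  have n1 : \forall t \near s, A (f t) := cf _ _ nA.
  have n2 : \forall t \near s, A (g t) := cg _ _ nA'.
  by near=> t; case: ifP => _; near: t.
Unshelve. all: by end_near. Qed.

Lemma comp_continuous {S T U : topologicalType} (g : T -> U) (f : S -> T) :
  continuous f -> continuous g -> continuous (fun s => g (f s)).
Proof. by move=> cf cg s; apply: continuous_comp; [exact: cf|exact: cg]. Qed.

Lemma pair_continuous {S T U : topologicalType} (f : S -> T) (g : S -> U) :
  continuous f -> continuous g -> continuous (fun s => (f s, g s)).
Proof. by move=> cf cg s; apply: cvg_pair; [exact: cf|exact: cg]. Qed.

Lemma fst_continuous {S T : topologicalType} : continuous (@fst S T).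
Proof. by move=> u; exact: cvg_fst. Qed.

Lemma snd_continuous {S T : topologicalType} : continuous (@snd S T).
Proof. by move=> u; exact: cvg_snd. Qed.

Lemma ival_fst_continuous {R : realType} {T : topologicalType} :
  continuous (fun u : unit_interval R * T => ival u.1).
Proof.
by apply: (comp_continuous (g := (@ival R))); [exact: fst_continuous|exact: ival_continuous].
Qed.

Lemma ival_snd_continuous {R : realType} {T : topologicalType} :
  continuous (fun u : T * unit_interval R => ival u.2).
Proof.
by apply: (comp_continuous (g := (@ival R))); [exact: snd_continuous|exact: ival_continuous].
Qed.

Section Homotopy.
Context (R : realType) (T : topologicalType).
Local Notation I := (unit_interval R).

Definition homotopic (x y : T) (p q : {path I from x to y}) :=
  exists H : I * I -> T, [/\ continuous H,
    forall s, H (s, zero) = p s /\ H (s, one) = q s &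
    forall t, H (zero, t) = x /\ H (one, t) = y].

Lemma path_continuous (x y : T) (p : {path I from x to y}) : continuous p.
Proof. exact: cts_fun. Qed.

Definition concat_fun (p q : I -> T) (s : I) : T :=
  if ival s <= 2^-1 then p (clamp (2 * ival s)) else q (clamp (2 * ival s - 1)).

Let mul2V : 2 * 2^-1 = 1 :> R.
Proof. by rewrite mulfV// pnatr_eq0. Qed.

Lemma scale_continuous (S : topologicalType) (h : S -> R) (a : R) :
  continuous h -> continuous (fun s => a * h s).
Proof. by move=> ch s; apply: cvgM; [exact: cvg_cst|exact: ch]. Qed.

Lemma affine_continuous (S : topologicalType) (h : S -> R) (a b : R) :
  continuous h -> continuous (fun s => a * h s - b).
Proof.
by move=> ch s; apply: cvgB; [exact: scale_continuous|exact: cvg_cst].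
Qed.

Lemma subr_continuous (S : topologicalType) (h : S -> R) (a : R) :
  continuous h -> continuous (fun s => a - h s).
Proof. by move=> ch s; apply: cvgB; [exact: cvg_cst|exact: ch]. Qed.

Lemma addr_continuous (S : topologicalType) (h : S -> R) (b : R) :
  continuous h -> continuous (fun s => h s + b).
Proof. by move=> ch s; apply: cvgD; [exact: ch|exact: cvg_cst]. Qed.

Lemma min_continuous (S : topologicalType) (h k : S -> R) :
  continuous h -> continuous k -> continuous (fun s => Num.min (h s) (k s)).
Proof. by move=> ch ck s; apply: (continuous_min (ch s) (ck s)). Qed.

Lemma clamp_comp_continuous (S : topologicalType) (h : S -> R) :
  continuous h -> continuous (fun s => clamp (h s) : I).
Proof.
by move=> ch s; apply: continuous_comp; [exact: ch|exact: clamp_continuous].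
Qed.

Section concat.
Context (x y z : T) (p : {path I from x to y}) (q : {path I from y to z}).

Fact concat_continuous : continuous (concat_fun p q).
Proof.
have cv : continuous (@ival R) by exact: ival_continuous.
apply: glue_continuous => //.
- apply: (comp_continuous (g := p)); last exact: path_continuous.
  by apply: clamp_comp_continuous; exact: scale_continuous.
- apply: (comp_continuous (g := q)); last exact: path_continuous.
  apply: clamp_comp_continuous.
    by first [exact: scale_continuous|exact: affine_continuous].
- move=> s ->; rewrite mul2V subrr clamp_ge1// clamp_le0//.
  by rewrite path_one path_zero.
Qed.

Fact concat_zero : concat_fun p q zero = x.
Proof.
rewrite /concat_fun ival_zero mulr0 ifT; last lra.
by rewrite clamp_le0// path_zero.
Qed.

Fact concat_one : concat_fun p q one = z.
Proof.
rewrite /concat_fun ival_one ifF; last lra.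
by rewrite clamp_ge1 ?path_one//; lra.
Qed.

Definition concat : {path I from x to z} :=
  mk_path concat_continuous concat_zero concat_one.
End concat.

Section reverse.
Context (x y : T) (p : {path I from x to y}).
Definition reverse_fun (s : I) : T := p (clamp (1 - ival s)).

Fact reverse_continuous : continuous reverse_fun.
Proof.
apply: (comp_continuous (g := p)); last exact: path_continuous.
by apply: clamp_comp_continuous; apply: subr_continuous; exact: ival_continuous.
Qed.

Fact reverse_zero : reverse_fun zero = y.
Proof. by rewrite /reverse_fun ival_zero subr0 clamp_ge1// path_one. Qed.

Fact reverse_one : reverse_fun one = x.
Proof. by rewrite /reverse_fun ival_one subrr clamp_le0// path_zero. Qed.

Definition reverse : {path I from y to x} :=
  mk_path reverse_continuous reverse_zero reverse_one.
End reverse.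

Lemma homotopic_refl (x y : T) (p : {path I from x to y}) : homotopic p p.
Proof.
exists (p \o fst); split => //=.
- apply: (comp_continuous (f := fst)); last exact: path_continuous.
  by move=> u; exact: cvg_fst.
- by move=> t; rewrite path_zero path_one.
Qed.

Lemma homotopic_sym (x y : T) (p q : {path I from x to y}) :
  homotopic p q -> homotopic q p.
Proof.
move=> [H [cH Hpq Hxy]]; exists (fun u => H (u.1, clamp (1 - ival u.2))); split => /=.
- apply: (comp_continuous (g := H)); last exact: cH.
  apply: pair_continuous; first exact: fst_continuous.
  apply: clamp_comp_continuous; apply: subr_continuous.
  exact: ival_snd_continuous.
- move=> s; rewrite ival_zero ival_one subr0 subrr clamp_ge1// clamp_le0//.
  by have [] := Hpq s.
- by move=> t.
Qed.

Lemma homotopic_trans (x y : T) (p q r : {path I from x to y}) :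
  homotopic p q -> homotopic q r -> homotopic p r.
Proof.
move=> [H [cH Hpq Hxy]] [K [cK Kqr Kxy]].
exists (fun u => if ival u.2 <= 2^-1 then H (u.1, clamp (2 * ival u.2))
  else K (u.1, clamp (2 * ival u.2 - 1))); split => /=.
- have cv : continuous (fun u : I * I => ival u.2).
  exact: ival_snd_continuous.
  apply: glue_continuous => //.
  + apply: (comp_continuous (g := H)); last exact: cH.
    apply: pair_continuous; first exact: fst_continuous.
    apply: clamp_comp_continuous.
    by first [exact: scale_continuous|exact: affine_continuous].
  + apply: (comp_continuous (g := K)); last exact: cK.
    apply: pair_continuous; first exact: fst_continuous.
    apply: clamp_comp_continuous.
    by first [exact: scale_continuous|exact: affine_continuous].
  + move=> u ->; rewrite mul2V subrr clamp_ge1// clamp_le0//.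
    by rewrite (Hpq _).2 (Kqr _).1.
- move=> s; rewrite ival_zero ival_one; split.
    by rewrite ifT ?mulr0 ?clamp_le0 ?(Hpq _).1//; lra.
  by rewrite ifF ?clamp_ge1 ?(Kqr _).2//; lra.
- move=> t; rewrite !(Hxy _).1 !(Hxy _).2 !(Kxy _).1 !(Kxy _).2.
  by rewrite !if_same.
Qed.

Lemma homotopic_concat (x y z : T) (p p' : {path I from x to y})
    (q q' : {path I from y to z}) :
  homotopic p p' -> homotopic q q' -> homotopic (concat p q) (concat p' q').
Proof.
move=> [H [cH Hpq Hxy]] [K [cK Kqr Kxy]].
exists (fun u => if ival u.1 <= 2^-1 then H (clamp (2 * ival u.1), u.2)
  else K (clamp (2 * ival u.1 - 1), u.2)); split => /=.
- have cv : continuous (fun u : I * I => ival u.1).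
    exact: ival_fst_continuous.
  apply: glue_continuous => //.
  + apply: (comp_continuous (g := H)); last exact: cH.
    apply: pair_continuous; last exact: snd_continuous.
    apply: clamp_comp_continuous.
    by first [exact: scale_continuous|exact: affine_continuous].
  + apply: (comp_continuous (g := K)); last exact: cK.
    apply: pair_continuous; last exact: snd_continuous.
    apply: clamp_comp_continuous.
    by first [exact: scale_continuous|exact: affine_continuous].
  + move=> u ->; rewrite mul2V subrr clamp_ge1// clamp_le0//.
    by rewrite (Hxy _).2 (Kxy _).1.
- move=> s; rewrite /mk_path /concat_fun.
  by rewrite (Hpq _).1 (Hpq _).2 (Kqr _).1 (Kqr _).2.
- move=> t; rewrite ival_zero ival_one; split.
    by rewrite ifT ?mulr0 ?clamp_le0 ?(Hxy _).1//; lra.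
  by rewrite ifF ?clamp_ge1 ?(Kxy _).2//; lra.
Qed.

(* Two reparameterizations with the same endpoints give homotopic paths. *)
Lemma homotopic_reparam (x y x' y' : T) (p : {path I from x' to y'})
    (a b : {path I from x to y}) (phi psi : I -> R) :
  continuous phi -> continuous psi ->
  phi zero = psi zero -> phi one = psi one ->
  (forall s, a s = p (clamp (phi s))) -> (forall s, b s = p (clamp (psi s))) ->
  homotopic a b.
Proof.
move=> cphi cpsi e0 e1 ha hb.
exists (fun u => p (clamp ((1 - ival u.2) * phi u.1 + ival u.2 * psi u.1))).
split => /=.
- apply: (comp_continuous (g := p)); last exact: path_continuous.
  apply: clamp_comp_continuous => u.
  have cv : {for u, continuous (fun u : I * I => ival u.2)}.
    exact: ival_snd_continuous.
  have c1 : {for u, continuous (phi \o fst)}.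
    by apply: continuous_comp; [exact: cvg_fst|exact: cphi].
  have c2 : {for u, continuous (psi \o fst)}.
    by apply: continuous_comp; [exact: cvg_fst|exact: cpsi].
  apply: cvgD; apply: cvgM => //.
  by apply: cvgB; [exact: cvg_cst|exact: cv].
- move=> s; rewrite ival_zero ival_one subr0 mul1r mul0r addr0 subrr mul0r mul1r.
  by rewrite add0r ha hb.
- move=> t; rewrite -e0 -e1 -!mulrDl subrK !mul1r -!ha.
  by rewrite path_zero path_one.
Qed.

Lemma concatE (x y z : T) (p : {path I from x to y}) (q : {path I from y to z})
    (s : I) : concat p q s =
  if ival s <= 2^-1 then p (clamp (2 * ival s)) else q (clamp (2 * ival s - 1)).
Proof. by []. Qed.

Lemma reverseE (x y : T) (p : {path I from x to y}) (s : I) :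
  reverse p s = p (clamp (1 - ival s)).
Proof. by []. Qed.

Lemma concat_cst (x y : T) (p : {path I from x to y}) :
  homotopic (concat p (cst y : {path I from y to y})) p.
Proof.
apply: (homotopic_reparam (p := p)
  (phi := fun s => ival (clamp (2 * ival s) : I)) (psi := @ival R)).
- apply: (comp_continuous (g := @ival R)); last exact: ival_continuous.
  by apply: clamp_comp_continuous; apply: scale_continuous; exact: ival_continuous.
- exact: ival_continuous.
- by rewrite ival_zero mulr0 clamp_le0// ival_zero.
- by rewrite ival_one mulr1 clamp_ge1 ?ival_one//; lra.
- move=> s; rewrite clampK concatE; case: ifPn => //; rewrite -ltNge => hs.
  by have -> : p (clamp (2 * ival s)) = y by rewrite clamp_ge1 ?path_one//; lra.
- by move=> s; rewrite clampK.
Qed.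

Lemma cst_concat (x y : T) (p : {path I from x to y}) :
  homotopic (concat (cst x : {path I from x to x}) p) p.
Proof.
apply: (homotopic_reparam (p := p)
  (phi := fun s => ival (clamp (2 * ival s - 1) : I)) (psi := @ival R)).
- apply: (comp_continuous (g := @ival R)); last exact: ival_continuous.
  by apply: clamp_comp_continuous; apply: affine_continuous; exact: ival_continuous.
- exact: ival_continuous.
- by rewrite ival_zero mulr0 clamp_le0 ?ival_zero//; lra.
- by rewrite ival_one mulr1 clamp_ge1 ?ival_one//; lra.
- move=> s; rewrite clampK concatE; case: ifPn => // hs.
  by have -> : p (clamp (2 * ival s - 1)) = x by rewrite clamp_le0 ?path_zero//; lra.
- by move=> s; rewrite clampK.
Qed.

Lemma concat_reverse (x y : T) (p : {path I from x to y}) :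
  homotopic (concat p (reverse p)) (cst x : {path I from x to x}).
Proof.
apply: (homotopic_reparam (p := p)
  (phi := fun s => 1 - `|2 * ival s - 1|) (psi := cst 0)).
- apply: subr_continuous.
  apply: (comp_continuous (g := fun u : R => `|u|)); last exact: norm_continuous.
  by apply: affine_continuous; exact: ival_continuous.
- exact: cst_continuous.
- by rewrite ival_zero mulr0 sub0r normrN normr1 subrr.
- by rewrite ival_one mulr1 (_ : 2 - 1 = 1 :> R) ?normr1 ?subrr//; lra.
- move=> s; rewrite concatE reverseE; have /andP[s0 s1] := unit_interval_bounds s.
  case: ifPn => [hs|]; first by rewrite ler0_norm; [congr (p (clamp _))|]; lra.
  rewrite -ltNge => hs; rewrite ger0_norm; last lra.
  by rewrite ival_clamp//; apply/andP; split; lra.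
- by move=> s; rewrite clamp_le0//= path_zero.
Qed.

Lemma reverseK (x y : T) (p : {path I from x to y}) : reverse (reverse p) = p.
Proof.
apply/path_eqP => s; rewrite !reverseE.
have /andP[s0 s1] := unit_interval_bounds s.
rewrite ival_clamp; last by apply/andP; split; lra.
by rewrite opprB addrC subrK clampK.
Qed.

Lemma homotopic_reverse (x y : T) (p q : {path I from x to y}) :
  homotopic p q -> homotopic (reverse p) (reverse q).
Proof.
move=> [H [cH Hpq Hxy]]; exists (fun u => H (clamp (1 - ival u.1), u.2)); split.
- apply: (comp_continuous (g := H)); last exact: cH.
  apply: pair_continuous; last exact: snd_continuous.
  apply: clamp_comp_continuous; apply: subr_continuous; exact: ival_fst_continuous.
- by move=> s; rewrite !reverseE; have [] := Hpq (clamp (1 - ival s)).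
- move=> t /=; rewrite ival_zero ival_one subr0 subrr clamp_ge1// clamp_le0//.
  by have [] := Hxy t.
Qed.

Lemma concatA (x y z w : T) (p : {path I from x to y}) (q : {path I from y to z})
    (r : {path I from z to w}) :
  homotopic (concat p (concat q r)) (concat (concat p q) r).
Proof.
apply/homotopic_sym/(homotopic_reparam (p := concat p (concat q r))
  (phi := fun s => Num.min (2 * ival s)
     (Num.min (ival s + 4^-1) (2^-1 * ival s + 2^-1))) (psi := @ival R)).
- have cv : continuous (@ival R) by exact: ival_continuous.
  apply: min_continuous; first exact: scale_continuous.
  apply: min_continuous; first exact: addr_continuous.
  by apply: addr_continuous; exact: scale_continuous.
- exact: ival_continuous.
- by rewrite ival_zero !mulr0 min_l// le_min; apply/andP; split; lra.
- rewrite ival_one min_r; last by rewrite ge_min; apply/orP; right; lra.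
  by rewrite min_r; lra.
- move=> s; have /andP[s0 s1] := unit_interval_bounds s.
  rewrite [LHS]concatE [RHS]concatE; case: ifPn => hs.
    rewrite concatE ival_clamp; last by apply/andP; split; lra.
    case: ifPn => hs'.
      rewrite min_l; last by rewrite le_min; apply/andP; split; lra.
      by rewrite ival_clamp; [rewrite hs'|apply/andP; split; lra].
    move: hs'; rewrite -ltNge => hs'.
    rewrite min_r; last by rewrite ge_min; apply/orP; left; lra.
    rewrite min_l; last lra.
    rewrite ival_clamp; last by apply/andP; split; lra.
    case: ifPn => hs''.
      have -> : 2 * (2 * ival s) - 1 = 0 by lra.
      have -> : 2 * (ival s + 4^-1) = 1 by lra.
      by rewrite clamp_le0// clamp_ge1// path_zero path_one.
    rewrite concatE ival_clamp; last by apply/andP; split; lra.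
    rewrite ifT; last lra.
    by congr (q (clamp _)); lra.
  move: hs; rewrite -ltNge => hs.
  rewrite min_r; last by rewrite ge_min; apply/orP; right; lra.
  rewrite min_r; last lra.
  rewrite ival_clamp; last by apply/andP; split; lra.
  rewrite ifF; last by apply/negbTE; rewrite -ltNge; lra.
  rewrite concatE ival_clamp; last by apply/andP; split; lra.
  rewrite ifF; last by apply/negbTE; rewrite -ltNge; lra.
  by congr (r (clamp _)); lra.
- by move=> s; rewrite clampK.
Qed.

End Homotopy.

Section FundamentalGroup.
Context (R : realType) (T : topologicalType) (x : T).
Local Notation I := (unit_interval R).
Local Notation loop := ({path I from x to x}).

Definition loop_rel (p q : loop) : bool := `[< homotopic p q >].

Fact loop_rel_refl : reflexive loop_rel.
Proof. by move=> p; apply/asboolP; exact: homotopic_refl. Qed.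

Fact loop_rel_sym : symmetric loop_rel.
Proof. by move=> p q; apply/asboolP/asboolP; exact: homotopic_sym. Qed.

Fact loop_rel_trans : transitive loop_rel.
Proof.
move=> q p r /asboolP pq /asboolP qr; apply/asboolP.
exact: homotopic_trans pq qr.
Qed.

Definition loop_equiv := EquivRel loop_rel loop_rel_refl loop_rel_sym loop_rel_trans.

Definition pi1 := {eq_quot loop_equiv}.

HB.instance Definition _ := Choice.on pi1.
HB.instance Definition _ := EqQuotient.on pi1.

Definition pi1_class (p : loop) : pi1 := \pi_pi1 p.

Lemma pi1_classP (p q : loop) : pi1_class p = pi1_class q <-> homotopic p q.
Proof.
by split=> [/eqmodP/asboolP//|pq]; apply/eqmodP/asboolP.
Qed.

Lemma homotopic_repr (p : loop) : homotopic (repr (pi1_class p)) p.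
Proof. by apply/pi1_classP; rewrite /pi1_class reprK. Qed.

Lemma pi1_ind (P : pi1 -> Prop) : (forall p, P (pi1_class p)) -> forall a, P a.
Proof. by move=> h a; have := h (repr a); rewrite /pi1_class reprK. Qed.

Definition pi1_one : pi1 := pi1_class (cst x).
Definition pi1_mul (a b : pi1) : pi1 := pi1_class (concat (repr a) (repr b)).
Definition pi1_inv (a : pi1) : pi1 := pi1_class (reverse (repr a)).

Lemma pi1_mulE (p q : loop) :
  pi1_mul (pi1_class p) (pi1_class q) = pi1_class (concat p q).
Proof. by apply/pi1_classP; apply: homotopic_concat; exact: homotopic_repr. Qed.

Lemma pi1_invE (p : loop) : pi1_inv (pi1_class p) = pi1_class (reverse p).
Proof. by apply/pi1_classP; apply: homotopic_reverse; exact: homotopic_repr. Qed.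

Fact pi1_mulA : associative pi1_mul.
Proof.
elim/pi1_ind=> p; elim/pi1_ind=> q; elim/pi1_ind=> r.
by rewrite !pi1_mulE; apply/pi1_classP; exact: concatA.
Qed.

Fact pi1_mul1g : left_id pi1_one pi1_mul.
Proof.
by elim/pi1_ind=> p; rewrite !pi1_mulE; apply/pi1_classP; exact: cst_concat.
Qed.

Fact pi1_mulg1 : right_id pi1_one pi1_mul.
Proof.
by elim/pi1_ind=> p; rewrite !pi1_mulE; apply/pi1_classP; exact: concat_cst.
Qed.

Fact pi1_mulgV : right_inverse pi1_one pi1_inv pi1_mul.
Proof.
elim/pi1_ind=> p; rewrite !pi1_invE !pi1_mulE; apply/pi1_classP.
exact: concat_reverse.
Qed.

Fact pi1_mulVg : left_inverse pi1_one pi1_inv pi1_mul.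
Proof.
elim/pi1_ind=> p; rewrite !pi1_invE !pi1_mulE -[in X in concat _ X](reverseK p).
by apply/pi1_classP; exact: concat_reverse.
Qed.

HB.instance Definition _ :=
  isGroup.Build pi1 pi1_mulA pi1_mul1g pi1_mulg1 pi1_mulVg pi1_mulgV.

End FundamentalGroup.

Section InducedMorphism.
Context (R : realType) (X Y : topologicalType) (f : continuousType X Y) (x : X).
Local Notation I := (unit_interval R).

Definition pi1_map (a : pi1 R x) : pi1 R (f x) :=
  pi1_class (f \o repr a : {path I from f x to f x}).

Lemma homotopic_comp (y : X) (p q : {path I from x to y}) :
  homotopic p q ->
  homotopic (f \o p : {path I from f x to f y}) (f \o q : {path I from f x to f y}).
Proof.
move=> [H [cH Hpq Hxy]]; exists (f \o H); split.
- by apply: (comp_continuous (g := f)); [exact: cH|exact: cts_fun].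
- by move=> s /=; rewrite (Hpq s).1 (Hpq s).2.
- by move=> t /=; rewrite (Hxy t).1 (Hxy t).2.
Qed.

Lemma pi1_mapE (p : {path I from x to x}) :
  pi1_map (pi1_class p) = pi1_class (f \o p : {path I from f x to f x}).
Proof. by apply/pi1_classP; apply: homotopic_comp; exact: homotopic_repr. Qed.

Fact pi1_mapM : {morph pi1_map : a b / (a * b)%g}.
Proof.
elim/pi1_ind=> p; elim/pi1_ind=> q.
rewrite [(_ * _)%g]pi1_mulE !pi1_mapE [RHS]pi1_mulE; congr pi1_class.
apply/path_eqP => s /=; rewrite /mk_path /concat_fun; by case: ifP.
Qed.

HB.instance Definition _ := isMultiplicative.Build (pi1 R x) (pi1 R (f x))
  pi1_map pi1_mapM.

End InducedMorphism.

(* pi1_map is a group morphism, so it is an isomorphism iff it is bijective. *)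
Definition pi1_isomorphism (R : realType) (X Y : topologicalType)
    (f : continuousType X Y) : Prop :=
  forall x : X, bijective (@pi1_map R X Y f x).

Definition homeomorphism_on (S T : topologicalType) (f : S -> T)
    (A : set S) (B : set T) : Prop :=
  [/\ set_bij A B f, {within A, continuous f} &
      forall W, open W -> exists2 O, open O & f @` (A `&` W) = B `&` O].

Section CWComplex.
Context (R : realType).

Definition sqnorm n (v : 'rV[R]_n) : R := \sum_(i < n) v 0 i ^+ 2.
Definition closed_disc n : set 'rV[R]_n := [set v | sqnorm v <= 1].
Definition open_disc n : set 'rV[R]_n := [set v | sqnorm v < 1].
Definition unit_sphere n : set 'rV[R]_n := [set v | sqnorm v = 1].
Arguments closed_disc n : clear implicits.
Arguments open_disc n : clear implicits.
Arguments unit_sphere n : clear implicits.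

(* A CW structure on X: the open cells partition X, the boundary of each cell
   lies in finitely many cells of smaller dimension, and X has the weak
   topology. Only the values of cell_map c on the closed disc matter. *)
Record cw_structure (X : topologicalType) := CWStructure {
  cell : Type;
  cell_dim : cell -> nat;
  cell_map : forall c, 'rV[R]_(cell_dim c) -> X;
  open_cell := fun c => @cell_map c @` open_disc (cell_dim c);
  cw_hausdorff : hausdorff_space X;
  cell_map_continuous : forall c,
    {within closed_disc (cell_dim c), continuous (@cell_map c)};
  cell_map_homeomorphism : forall c,
    homeomorphism_on (@cell_map c) (open_disc (cell_dim c)) (open_cell c);
  cell_partition : forall x, exists! c, open_cell c x;
  cw_closure_finite : forall c, exists F : set cell,
    [/\ finite_set F, (forall c', F c' -> (cell_dim c' < cell_dim c)%N) &
        @cell_map c @` unit_sphere (cell_dim c)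
          `<=` \bigcup_(c' in F) open_cell c'];
  cw_weak_topology : forall A : set X,
    closed A <-> forall c,
      closed (closed_disc (cell_dim c) `&` @cell_map c @^-1` A) }.

End CWComplex.

Section Covering.
Context (E X : topologicalType) (p : E -> X).

Definition evenly_covered (U : set X) : Prop :=
  exists S : set (set E), [/\ trivIset S id,
    \bigcup_(V in S) V = p @^-1` U &
    forall V, S V -> open V /\ homeomorphism_on p V U].

Definition covering_map : Prop :=
  [/\ continuous p, set_surj [set: E] [set: X] p &
      forall x, exists U, [/\ open U, U x & evenly_covered U]].

Definition deck_transformation (g : E -> E) : Prop :=
  exists h : E -> E,
    [/\ continuous g, continuous h, cancel g h, cancel h g & p \o g = p].

Lemma deck_transformation_id : deck_transformation id.
Proof. by exists id; split => // ?; exact: cvg_id. Qed.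

Lemma deck_transformation_comp g g' :
  deck_transformation g -> deck_transformation g' ->
  deck_transformation (g \o g').
Proof.
move=> [h [cg ch gK hK pg]] [h' [cg' ch' gK' hK' pg']].
exists (h' \o h); split.
- exact: (comp_continuous cg' cg).
- exact: (comp_continuous ch ch').
- exact: can_comp.
- exact: can_comp.
- by rewrite compA pg pg'.
Qed.

Lemma deck_transformation_inv g : deck_transformation g ->
  exists2 h, deck_transformation h & cancel g h.
Proof.
move=> [h [cg ch gK hK pg]]; exists h => //; exists g; split => //.
by rewrite -[in LHS]pg; apply/funext => e /=; rewrite hK.
Qed.

End Covering.

Definition simply_connected (R : realType) (E : topologicalType) : Prop :=
  [/\ [set: E] !=set0,
      (forall x y : E, inhabited {path (unit_interval R) from x to y}) &
      forall (x : E) (a : pi1 R x), a = 1%g].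

Definition universal_cover (R : realType) (E X : topologicalType)
    (p : E -> X) : Prop :=
  covering_map p /\ simply_connected R E.

(* The fundamental group of X acts on the total space of a universal cover p as
   the group of all deck transformations of p; two m-tuples are identified when
   a single deck transformation carries one to the other. *)
Section OrbitSpace.
Context (E X : topologicalType) (p : E -> X) (m : nat).

Definition diagonal_rel (u v : {ptws 'I_m -> E}) : bool :=
  `[< exists2 g, deck_transformation p g & forall i, v i = g (u i) >].

Fact diagonal_rel_refl : reflexive diagonal_rel.
Proof.
by move=> u; apply/asboolP; exists id => //; exact: deck_transformation_id.
Qed.

Fact diagonal_rel_sym : symmetric diagonal_rel.
Proof.
suff h u v : diagonal_rel u v -> diagonal_rel v u.
  by move=> u v; apply/idP/idP; exact: h.
move=> /asboolP[g /deck_transformation_inv[h dh gK] uv]; apply/asboolP.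
by exists h => // i; rewrite uv gK.
Qed.

Fact diagonal_rel_trans : transitive diagonal_rel.
Proof.
move=> v u w /asboolP[g dg uv] /asboolP[h dh vw]; apply/asboolP.
exists (h \o g); first exact: deck_transformation_comp.
by move=> i; rewrite vw uv.
Qed.

Definition diagonal_equiv :=
  EquivRel diagonal_rel diagonal_rel_refl diagonal_rel_sym diagonal_rel_trans.

Definition orbit_space := quotient_topology {eq_quot diagonal_equiv}.

HB.instance Definition _ := Topological.on orbit_space.
HB.instance Definition _ := Quotient.on orbit_space.

Definition orbit_map (c : orbit_space) : {ptws 'I_m -> X} :=
  fun i => p (repr c i).

Lemma orbit_mapE (u : {ptws 'I_m -> E}) :
  orbit_map (\pi_orbit_space u) = (fun i => p (u i)).
Proof.
have /eqmodP/asboolP[g [_ [_ _ _ _ pg]] gu] :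
    \pi_{eq_quot diagonal_equiv} (repr (\pi_orbit_space u)) =
    \pi_{eq_quot diagonal_equiv} u by exact: reprK.
by apply/funext => i; rewrite gu; exact: (esym (congr1 (fun k : E -> X => k _) pg)).
Qed.

End OrbitSpace.

Section Measures.
Context (R : realType) (Z : topologicalType).

Definition support (mu : Z -> R) : set Z := [set z | mu z != 0].

(* Probability measures on Z supported on at most n points, encoded by their
   mass functions: mu stands for the sum of the mu z * delta_z. *)
Record nmeasure (n : nat) := NMeasure {
  mass :> Z -> R;
  mass_ge0 : forall z, 0 <= mass z;
  mass_support : support mass #<= `I_n;
  mass_total : \sum_(z \in [set: Z]) mass z = 1 }.

HB.instance Definition _ n := gen_eqMixin (nmeasure n).
HB.instance Definition _ n := gen_choiceMixin (nmeasure n).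

Definition bounded_continuous : Type :=
  {phi : Z -> R | continuous phi /\ exists M, forall z, `|phi z| <= M}.

Definition expectation n (mu : nmeasure n) : {ptws bounded_continuous -> R} :=
  fun phi => \sum_(z \in [set: Z]) mu z * sval phi z.

(* The topology of weak convergence: the coarsest one for which the integral of
   every bounded continuous function is continuous. *)
HB.instance Definition _ n :=
  Topological.copy (nmeasure n) (initial_topology (@expectation n)).

End Measures.

Section DistributionalSectionalCategory.
Context (R : realType) (E B : topologicalType) (f : E -> B).

Definition fiberwise (n : nat) : set (nmeasure R E n) :=
  [set mu | exists b, support mu `<=` f @^-1` [set b]].
Arguments fiberwise n : clear implicits.

Definition fiberwise_map n (mu : fiberwise n) : B :=
  projT1 (cid (set_valP mu)).

Definition has_section n : Prop :=
  exists s : B -> fiberwise n, continuous s /\ cancel s (@fiberwise_map n).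

(* the least n such that f_(n+1) has a section, +oo if there is none *)
Definition dsecat : \bar R :=
  match pselect (exists n, `[< has_section n.+1 >]) with
  | left h => (ex_minn h)%:R%:E
  | right _ => +oo%E
  end.

End DistributionalSectionalCategory.

Definition diagonal_dTC (R : realType) (m : nat) (E X : topologicalType)
    (p : E -> X) : \bar R :=
  dsecat R (@orbit_map E X p m).

(* Main.v *)
(* The map [f] lifts to the universal covers; it is equivariant for the
   isomorphism of fundamental groups and bijective on fibres, so it induces a
   map of orbit spaces which is bijective on the fibres of the two covers of
   [X^m] and [Y^m]. A section over [Y^m] is transported fibrewise to [X^m].
   Weak continuity of the result: bump functions on the cover of [Y^m], which
   exist because CW complexes are completely regular, isolate one point of a
   fibre and show that the weights of the measures vary continuously along
   local sections; since the total mass is 1, nothing escapes. *)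

Require Import Defs.
From HB Require Import structures.
From mathcomp Require Import all_boot all_order all_algebra generic_quotient.
From mathcomp Require Import all_classical all_reals topology normedtype.
From mathcomp Require Import homotopy ring lra.
From mathcomp Require numfun.

Set Implicit Arguments.
Unset Strict Implicit.
Unset Printing Implicit Defensive.

Import Order.TTheory GRing.Theory Num.Theory numFieldNormedType.Exports.

Local Open Scope classical_set_scope.
Local Open Scope ring_scope.
Local Open Scope quotient_scope.

(** * Sheets of a covering map *)

(** The two halves of the hypothesis on fundamental groups separate: injectivity makes the lift [F]
    injective on fibres, surjectivity makes it surjective there. The obstacle is weak continuity.
    The given section is continuous against test functions on the orbit space of [Yt], but its
    transport must be tested against functions on the orbit space of [Xt], which need not factor
    through the induced map. Individual weights are therefore recovered first. Even then, measures
    over nearby points may put small weights on sheets that carry none at [x], so following the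
    finitely many atoms at [x] bounds integrals only from below, and only for nonnegative test
    functions. If [phi] is bounded by [M], this one-sided bound is applied to both [M + phi] and
    [M - phi]; as every measure has mass 1, the constant drops out and the two bounds become
    continuity. Deck transformations stand for the fundamental group throughout, so facts about its
    action are derived from uniqueness and existence of lifts. *)

Lemma locally_constant_connected (T : topologicalType) (C : Type) (h : T -> C) :
  connected [set: T] -> (forall t, \forall t' \near t, h t' = h t) ->
  forall t t', h t = h t'.
Proof.
move=> cT lc t t'; pose A := [set u | h u = h t].
have oA : open A.
  rewrite openE => u Au; have := lc u; apply: filterS => v vu.
  by rewrite /A /= vu.
have cA : closed A.
  rewrite -openC openE => u nAu; have := lc u; apply: filterS => v vu Av.
  by apply: nAu; rewrite /A /= -vu.
have AT : A = [set: T].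
  by apply: cT; [exists t|exists A => //; rewrite setTI|exists A => //; rewrite setTI].
by have : A t' by rewrite AT.
Qed.

Lemma connected_surj (S T : topologicalType) (f : S -> T) :
  connected [set: S] -> continuous f -> (forall t, exists s, f s = t) ->
  connected [set: T].
Proof.
move=> cS cf sf; have -> : [set: T] = f @` [set: S].
  by apply/seteqP; split => // t _; have [s <-] := sf t; exists s.
by apply: connected_continuous_connected => //; apply: continuous_subspaceT.
Qed.

Lemma connected_realType (R : realType) : connected [set: R].
Proof. by apply/connected_intervalP. Qed.

Lemma connected_unit_interval (R : realType) : connected [set: unit_interval R].
Proof.
apply: (connected_surj (@connected_realType R) (@clamp_continuous R)) => s.
by exists (ival s); rewrite clampK.
Qed.

Section Sheets.
Context (E B : topologicalType) (q : E -> B).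

(* [sheet e] is the section over [U] whose image is the sheet through [e]. *)
Definition trivialization (U : set B) (sheet : E -> B -> E) :=
  forall e, U (q e) -> [/\ sheet e (q e) = e,
    forall y, U y -> [/\ q (sheet e y) = y, {for y, continuous (sheet e)} &
      sheet (sheet e y) = sheet e] &
    \forall e' \near e, sheet e' = sheet e].

(** One section is chosen per sheet, not per point. Points of the same sheet thus get literally the
    same function, values outside [U] included. *)
Lemma evenly_covered_trivialization (U : set B) : open U ->
  evenly_covered q U -> exists sheet, trivialization U sheet.
Proof.
move=> oU [S [tS cS hS]].
have [[edflt]|nE] := pselect (inhabited E); last first.
  by exists (fun e _ => e) => e; case: nE.
have /choice[V hV] : forall e, exists V, U (q e) -> S V /\ V e.
  move=> e; have [Ue|nU] := pselect (U (q e)); last by exists set0.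
  have : (q @^-1` U) e by [].
  by rewrite -cS => -[V SV Ve]; exists V.
have VE W e : S W -> W e -> U (q e) -> V e = W.
  move=> SW We Ue; have [SV Ve] := hV _ Ue.
  by apply: tS => //; exists e.
have /choice[sec hsec] : forall W, exists s : B -> E,
    S W -> forall y, U y -> W (s y) /\ q (s y) = y.
  move=> W; have [SW|nS] := pselect (S W); last by exists (fun=> edflt).
  have [oW [[_ _ surj] _ _]] := hS _ SW.
  suff /choice[s hs] : forall y, exists e, U y -> W e /\ q e = y by exists s.
  move=> y; have [Uy|nU] := pselect (U y); last by exists edflt.
  by have [e We <-] := surj _ Uy; exists e.
have secK W e : S W -> W e -> U (q e) -> sec W (q e) = e.
  move=> SW We Ue; have [_ [[_ inj _] _ _]] := hS _ SW.
  by have [h1 h2] := hsec _ SW _ Ue; apply: inj; rewrite ?inE.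
exists (fun e => sec (V e)) => e Ue; have [SV Ve] := hV _ Ue; split.
- exact: secK.
- move=> y Uy; have [Vs qs] := hsec _ SV _ Uy; split => //; last first.
    by rewrite (VE (V e)) // qs.
  move=> N /= /nbhs_interior; set W := interior N => nW.
  have [oV [[_ inj _] _ img]] := hS _ SV.
  have [O oO VWO] := img _ (open_interior N).
  have OU : (U `&` O) y.
    by rewrite -VWO; exists (sec (V e) y) => //; split => //; exact: nbhs_singleton nW.
  have : nbhs y (U `&` O) by apply: open_nbhs_nbhs; split => //; exact: openI.
  apply: filterS => z; rewrite -VWO => -[e' [Ve' We'] <-].
  have Uz : U (q e').
    have : (\bigcup_(V0 in S) V0) e' by exists (V e).
    by rewrite cS.
  by rewrite /= (secK (V e)) //; exact: interior_subset.
- have [oV _] := hS _ SV.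
  have : nbhs e (V e) by apply: open_nbhs_nbhs.
  apply: filterS => e' Ve'; rewrite (VE (V e)) //.
  have : (\bigcup_(V0 in S) V0) e' by exists (V e).
  by rewrite cS.
Qed.

Hypothesis covq : covering_map q.

Lemma covering_trivialization (y : B) :
  exists U sheet, [/\ open U, U y & trivialization U sheet].
Proof.
have [_ _ /(_ y)[U [oU Uy /(evenly_covered_trivialization oU)[sh tsh]]]] := covq.
by exists U, sh.
Qed.

Lemma covering_continuous : continuous q.
Proof. by have [] := covq. Qed.

Lemma near_evenly_covered (U : set B) e : open U -> U (q e) ->
  \forall e' \near e, U (q e').
Proof.
move=> oU Ue; have nU : nbhs (q e) U by exact: open_nbhs_nbhs.
exact: (@covering_continuous e _ nU).
Qed.

(** Near [u] each lift stays in the sheet it occupies at [u], so the truth value of [g1 t = g2 t] is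
    locally constant. This treats openness and closedness of the agreement set at once, without a
    Hausdorff condition on [E]. *)
Lemma lift_unique (T : topologicalType) (g1 g2 : T -> E) :
  connected [set: T] -> continuous g1 -> continuous g2 ->
  (forall t, q (g1 t) = q (g2 t)) ->
  forall t0, g1 t0 = g2 t0 -> forall t, g1 t = g2 t.
Proof.
move=> cT cg1 cg2 qg t0 e0 t.
suff <- : (g1 t0 = g2 t0) = (g1 t = g2 t) by [].
apply: (locally_constant_connected (h := fun t => g1 t = g2 t)) => // {e0}u.
have [U [sh [oU Uy tsh]]] := covering_trivialization (q (g1 u)).
have Uy2 := Uy; rewrite qg in Uy2.
have n1 : \forall v \near u, sh (g1 v) = sh (g1 u).
  by have [_ _ h] := tsh _ Uy; exact: (cg1 u _ h).
have n2 : \forall v \near u, sh (g2 v) = sh (g2 u).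
  by have [_ _ h] := tsh _ Uy2; exact: (cg2 u _ h).
have n3 : \forall v \near u, U (q (g1 v)).
  exact: (cg1 u _ (near_evenly_covered oU Uy)).
near=> v.
have Uv : U (q (g1 v)) by near: v.
have s1 : sh (g1 v) = sh (g1 u) by near: v.
have s2 : sh (g2 v) = sh (g2 u) by near: v.
have Uv2 := Uv; rewrite qg in Uv2.
have [e1 _ _] := tsh _ Uv; have [e2 _ _] := tsh _ Uv2.
have [e3 _ _] := tsh _ Uy; have [e4 _ _] := tsh _ Uy2.
apply/propext; split=> h.
  by rewrite -e3 -e4 -s1 -s2 h qg.
by rewrite -e1 -e2 s1 s2 h qg.
Unshelve. all: by end_near. Qed.

Lemma sheet_connected (U : set B) sheet (T : topologicalType) (g : T -> E) :
  trivialization U sheet -> connected [set: T] -> continuous g ->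
  (forall t, U (q (g t))) -> forall t t', sheet (g t) = sheet (g t').
Proof.
move=> tsh cT cg Ug; apply: locally_constant_connected => // t.
by have [_ _ h] := tsh _ (Ug t); exact: (cg t _ h).
Qed.

Lemma sheet_lift_continuous (U : set B) sheet (T : topologicalType) (g : T -> B) e :
  trivialization U sheet -> U (q e) -> continuous g -> (forall t, U (g t)) ->
  continuous (fun t => sheet e (g t)).
Proof.
move=> tsh Ue cg Ug t; apply: continuous_comp; first exact: cg.
by have [_ /(_ _ (Ug t))[]] := tsh _ Ue.
Qed.

End Sheets.

(** * Homotopy lifting *)

(** Compactness of the interval as an induction principle, replacing subdivision by a Lebesgue
    number. The supremum of the points reached from [a] is itself reached, and can be passed unless
    it equals [b]. *)
Lemma interval_gluing_ind (R : realType) (P : R -> R -> Prop) (a b : R) :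
  a <= b ->
  (forall x y z, x <= y -> y <= z -> P x y -> P y z -> P x z) ->
  (forall x, a <= x <= b -> exists2 e, 0 < e &
    forall y z, x - e < y -> y <= z -> z < x + e -> P y z) ->
  P a b.
Proof.
move=> ab glue loc; pose A := [set x | a <= x <= b /\ P a x].
have Aa : A a.
  split; first by rewrite lexx.
  by have [|e e0] := loc a; [rewrite lexx|apply; lra].
have supA : has_sup A by split; [exists a|exists b => x [/andP[]]].
have as_ : a <= sup A by apply: sup_upper_bound.
have sb : sup A <= b by apply: ge_sup; [exists a|move=> x [/andP[]]].
have [|e e0 Pe] := loc (sup A); first by rewrite as_.
have [x [/andP[ax xb] Pax] sx] := sup_adherent e0 supA.
have xs : x <= sup A by apply: sup_upper_bound => //; split => //; rewrite ax.
have Pas : P a (sup A) by apply: glue Pax _ => //; apply: Pe => //; lra.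
have [bs|sltb] := leP b (sup A).
  by have -> : b = sup A by apply/le_anti/andP.
have zP : exists z, [/\ sup A < z, z <= b & z < sup A + e].
  by have [h|h] := leP (sup A + e / 2) b; [exists (sup A + e / 2)|exists b]; split; lra.
have [z [sz zb ze]] := zP.
suff /(sup_upper_bound supA) : A z by rewrite leNgt sz.
split; first by apply/andP; split; lra.
by apply: glue Pas _; [lra|lra|apply: Pe; lra].
Qed.

Section Clamping.
Context (R : realType).

(** For [a <= b] this retracts the line onto [[a, b]]. Precomposing with it turns a map on a
    rectangle into one on the whole plane, so that no subspace topologies occur in the gluing. *)
Definition bracket (a b t : R) : R := Num.max a (Num.min t b).

Lemma bracket_continuous a b : continuous (bracket a b).
Proof.
move=> t; apply: (@continuous_max _ _ (cst a) (fun u : R => Num.min u b)).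
  exact: cst_continuous.
apply: (@continuous_min _ _ id (cst b)); first exact: cvg_id.
exact: cst_continuous.
Qed.

Lemma bracket_bounds a b t : a <= b -> a <= bracket a b t <= b.
Proof. by move=> ab; rewrite /bracket le_max lexx /= ge_max ab ge_min lexx orbT. Qed.

Lemma bracket_left a b c t : b <= c -> t <= b -> bracket a c t = bracket a b t.
Proof. by move=> bc tb; rewrite /bracket !min_l//; lra. Qed.

Lemma bracket_right a b c t : a <= b -> b <= c -> b <= t ->
  bracket a c t = bracket b c t.
Proof.
move=> ab bc bt; rewrite /bracket.
have h : b <= Num.min t c by rewrite le_min bt bc.
by rewrite !max_r//; lra.
Qed.

Lemma bracket01 t : bracket 0 1 t = clamp_val t.
Proof. by []. Qed.

End Clamping.

Section Lifting.
Context (R : realType) (E B : topologicalType) (q : E -> B).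
Hypothesis covq : covering_map q.
Local Notation I := (unit_interval R).

(** The starting point is universally quantified because gluing restarts the lift of the second
    piece at a point of the common edge. *)
Definition liftable (T : topologicalType) (k : T -> B) :=
  forall t0 e0, q e0 = k t0 ->
  exists G : T -> E, [/\ continuous G, forall t, q (G t) = k t & G t0 = e0].

Lemma liftable_trivialization (T : topologicalType) (k : T -> B) U sheet :
  trivialization q U sheet -> continuous k -> (forall t, U (k t)) -> liftable k.
Proof.
move=> tsh ck Uk t0 e0 qe0; have Ue0 : U (q e0) by rewrite qe0.
exists (fun t => sheet e0 (k t)); split.
- exact: (sheet_lift_continuous tsh).
- by move=> t; have [_ /(_ _ (Uk t))[]] := tsh _ Ue0.
- by rewrite -qe0; have [] := tsh _ Ue0.
Qed.

(* [j] parameterizes the common edge [h = b], where uniqueness of lifts makes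
   the two pieces agree. *)
Lemma liftable_glue (T : topologicalType) (h : T -> R) (j : R -> T) (b : R)
    (k k1 k2 : T -> B) :
  continuous h -> continuous j -> (forall r, h (j r) = b) ->
  (forall t, h t = b -> exists r, j r = t) ->
  (forall t, h t <= b -> k t = k1 t) -> (forall t, b <= h t -> k t = k2 t) ->
  liftable k1 -> liftable k2 -> liftable k.
Proof.
move=> ch cj hj jh kk1 kk2 lk1 lk2.
have glue G1 G2 : continuous G1 -> continuous G2 ->
    (forall t, q (G1 t) = k1 t) -> (forall t, q (G2 t) = k2 t) ->
    G1 (j 0) = G2 (j 0) ->
    let G := fun t => if h t <= b then G1 t else G2 t in
    continuous G /\ forall t, q (G t) = k t.
  move=> c1 c2 q1 q2 e0 /=; split.
    apply: glue_continuous => // t /jh[r <-].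
    apply: (lift_unique covq (g1 := G1 \o j) (g2 := G2 \o j)
      (@connected_realType R) _ _ _ e0).
    + exact: (comp_continuous cj c1).
    + exact: (comp_continuous cj c2).
    + by move=> s /=; rewrite q1 q2 -kk1 ?hj// -kk2 ?hj.
  move=> t; have [tb|bt] := leP (h t) b; first by rewrite q1 kk1.
  by rewrite q2 kk2// ltW.
move=> t0 e0 qe0; have [tb|bt] := leP (h t0) b.
- have [|G1 [c1 q1 G1e]] := lk1 t0 e0; first by rewrite -kk1.
  have [|G2 [c2 q2 G2e]] := lk2 (j 0) (G1 (j 0)).
    by rewrite q1 -kk1 ?hj// -kk2 ?hj.
  have [cG qG] := glue G1 G2 c1 c2 q1 q2 (esym G2e).
  by eexists; split; [exact: cG|exact: qG|rewrite /= tb].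
- have [|G2 [c2 q2 G2e]] := lk2 t0 e0; first by rewrite -kk2// ltW.
  have [|G1 [c1 q1 G1e]] := lk1 (j 0) (G2 (j 0)).
    by rewrite q2 -kk1 ?hj// -kk2 ?hj.
  have [cG qG] := glue G1 G2 c1 c2 q1 q2 G1e.
  by eexists; split; [exact: cG|exact: qG|rewrite /= leNgt bt].
Qed.

(** Two nested interval inductions. The inner one glues small rectangles along the second
    coordinate; its relation carries a width [e], of which gluing takes the minimum, so a whole
    strip of positive width around [s] results. The outer one glues the strips. *)
Lemma square_liftable (H : R * R -> B) : continuous H ->
  liftable (fun z => H (bracket 0 1 z.1, bracket 0 1 z.2)).
Proof.
move=> cH.
pose K a b c d := fun z : R * R => H (bracket a b z.1, bracket c d z.2).
have cK a b c d : continuous (K a b c d).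
  apply: (comp_continuous (g := H)); last exact: cH.
  by apply: pair_continuous; apply: (comp_continuous _ (@bracket_continuous R _ _));
    [exact: fst_continuous|exact: snd_continuous].
have gl1 a b c d d' : a <= b -> b <= c ->
    liftable (K a b d d') -> liftable (K b c d d') -> liftable (K a c d d').
  move=> ab bc; apply: (liftable_glue (h := fst) (j := fun r => (b, r)) (b := b)) => //.
  + by move=> z; exact: cvg_fst.
  + by apply: (pair_continuous (f := cst b) (g := @id R)) => ?;
      [exact: cst_continuous|exact: cvg_id].
  + by move=> [s t] /= ->; exists t.
  + by move=> t tb; rewrite /K (@bracket_left _ a b).
  + by move=> t tb; rewrite /K (@bracket_right _ a b).
have gl2 a b c d d' : a <= b -> b <= c ->
    liftable (K d d' a b) -> liftable (K d d' b c) -> liftable (K d d' a c).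
  move=> ab bc; apply: (liftable_glue (h := snd) (j := fun r => (r, b)) (b := b)) => //.
  + by move=> z; exact: cvg_snd.
  + by apply: (pair_continuous (f := @id R) (g := cst b)) => ?;
      [exact: cvg_id|exact: cst_continuous].
  + by move=> [s t] /= ->; exists s.
  + by move=> t tb; rewrite /K (@bracket_left _ a b).
  + by move=> t tb; rewrite /K (@bracket_right _ a b).
have loc s t : exists2 e, 0 < e & forall a b c d, a <= b -> c <= d ->
    s - e < a -> b < s + e -> t - e < c -> d < t + e -> liftable (K a b c d).
  have [U [sh [oU Uy tsh]]] := covering_trivialization covq (H (s, t)).
  have /cH : nbhs (H (s, t)) U by exact: open_nbhs_nbhs.
  move=> /nbhs_ballP[e /= e0 He]; exists e => // a b c d ab cd sa bs tc dt.
  apply: (liftable_trivialization tsh) => // z; apply: He.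
  have /andP[h1 h2] := bracket_bounds z.1 ab.
  have /andP[h3 h4] := bracket_bounds z.2 cd.
  by split; rewrite /ball /= ltr_norml; apply/andP; split; lra.
have strip s : exists2 e, 0 < e & forall a b, a <= b -> s - e < a -> b < s + e ->
    liftable (K a b 0 1).
  apply: (interval_gluing_ind (P := fun c d => exists2 e, 0 < e & forall a b,
    a <= b -> s - e < a -> b < s + e -> liftable (K a b c d))) => //.
  - move=> x y z xy yz [e e0 he] [e' e0' he'].
    exists (Num.min e e'); first by rewrite lt_min e0.
    move=> a b ab sa bs; have [h1 h2] : Num.min e e' <= e /\ Num.min e e' <= e'.
      by rewrite !ge_min !lexx orbT.
    by apply: (gl2 _ _ _ _ _ xy yz); [apply: he|apply: he'] => //; lra.
  - move=> t _; have [e e0 he] := loc s t; exists e => // c d tc cd dt.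
    by exists e => // a b ab sa bs; apply: he => //; lra.
apply: (interval_gluing_ind (P := fun a b => liftable (K a b 0 1))) => //.
- by move=> x y z xy yz; apply: gl1.
- move=> s _; have [e e0 he] := strip s; exists e => // a b sa ab bs.
  exact: he.
Qed.

Lemma square_lift (H : I * I -> B) (e0 : E) : continuous H ->
  q e0 = H (zero, zero) ->
  exists G : I * I -> E,
    [/\ continuous G, forall z, q (G z) = H z & G (zero, zero) = e0].
Proof.
move=> cH qe0.
pose H' := fun z : R * R => H (clamp z.1, clamp z.2).
have cH' : continuous H'.
  apply: (comp_continuous (g := H)); last exact: cH.
  by apply: pair_continuous; apply: (comp_continuous _ (@clamp_continuous R));
    [exact: fst_continuous|exact: snd_continuous].
have [|G [cG qG Ge]] := square_liftable cH' (t0 := (0, 0)) (e0 := e0).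
  by rewrite qe0 /H' !bracket01 /= !clamp_le0// clamp_val_le0.
have ci := @ival_continuous R.
exists (fun z => G (ival z.1, ival z.2)); split.
- apply: (comp_continuous (g := G)); last exact: cG.
  by apply: pair_continuous; [exact: ival_fst_continuous|exact: ival_snd_continuous].
- move=> z; rewrite qG /H' !bracket01 /= !clamp_val_id ?unit_interval_bounds//.
  by rewrite !clampK; case: z.
- by rewrite !ival_zero.
Qed.

Lemma path_lift (g : I -> B) (e0 : E) : continuous g -> q e0 = g zero ->
  exists G : I -> E, [/\ continuous G, forall s, q (G s) = g s & G zero = e0].
Proof.
move=> cg qe0; have [||G [cG qG Ge]] := @square_lift (fun z => g z.1) e0 => //.
  exact: (comp_continuous (@fst_continuous _ _) cg).
exists (fun s => G (s, zero)); split => //.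
apply: (comp_continuous (g := G)); last exact: cG.
by apply: pair_continuous; [move=> ?; exact: cvg_id|exact: cst_continuous].
Qed.

(** The vertical edges of the lifted square lie over single points, hence are constant by uniqueness
    of lifts; its horizontal edges are [g1] and [g2] for the same reason. *)
Lemma monodromy (H : I * I -> B) (g1 g2 : I -> E) : continuous H ->
  (forall t, H (zero, t) = H (zero, zero)) ->
  (forall t, H (one, t) = H (one, zero)) ->
  continuous g1 -> continuous g2 ->
  (forall s, q (g1 s) = H (s, zero)) -> (forall s, q (g2 s) = H (s, one)) ->
  g1 zero = g2 zero -> g1 one = g2 one.
Proof.
move=> cH Hz Ho c1 c2 q1 q2 e0.
have [||G [cG qG Ge]] := @square_lift H (g1 zero) => //.
have cGh t : continuous (fun s => G (s, t)).
  apply: (comp_continuous (g := G)); last exact: cG.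
  by apply: pair_continuous; [move=> ?; exact: cvg_id|exact: cst_continuous].
have cGv s : continuous (fun t => G (s, t)).
  apply: (comp_continuous (g := G)); last exact: cG.
  by apply: pair_continuous; [exact: cst_continuous|move=> ?; exact: cvg_id].
have conn := @connected_unit_interval R.
have cst_lift s : (forall t, H (s, t) = H (s, zero)) -> G (s, one) = G (s, zero).
  move=> Hs; apply: (lift_unique covq conn (cGv s)
    (g2 := fun=> G (s, zero)) _ _ (t0 := zero)) => //; first exact: cst_continuous.
  by move=> t; rewrite !qG.
have G1 : G (one, zero) = g1 one.
  by apply: (lift_unique covq conn (cGh zero) c1 _ Ge) => s; rewrite qG q1.
have G0 : G (zero, one) = g2 zero by rewrite cst_lift ?Ge.
rewrite -G1 -(cst_lift one) //.
by apply: (lift_unique covq conn (cGh one) c2 _ G0) => s; rewrite qG q2.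
Qed.

End Lifting.

(** * The lifting criterion *)

(** The points reachable from [t] inside [U] are only required to form a neighbourhood, not an open
    set. Imposed at every point, this is equivalent to local path connectedness, and it passes
    directly to covers. *)
Definition weakly_locally_path_connected (R : realType) (T : topologicalType) :=
  forall (t : T) (U : set T), nbhs t U -> \forall t' \near t,
    exists g : unit_interval R -> T,
      [/\ continuous g, g zero = t, g one = t' & forall s, U (g s)].

Lemma near_sheet_section (E B : topologicalType) (q : E -> B) (U : set B) sheet e :
  covering_map q -> open U -> trivialization q U sheet -> U (q e) ->
  \forall e' \near e, U (q e') /\ sheet e (q e') = e'.
Proof.
move=> covq oU tsh Ue; have [_ _ he] := tsh _ Ue.
have nU := near_evenly_covered covq oU Ue.
near=> e'; have Ue' : U (q e') by near: e'.
have <- : sheet e' = sheet e by near: e'.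
by have [] := tsh _ Ue'.
Unshelve. all: by end_near. Qed.

Section SimplyConnected.
Context (R : realType).
Local Notation I := (unit_interval R).

Lemma cover_weakly_locally_path_connected (E B : topologicalType) (q : E -> B) :
  covering_map q -> weakly_locally_path_connected R B ->
  weakly_locally_path_connected R E.
Proof.
move=> covq wB e U nU.
have [W [sh [oW We tsh]]] := covering_trivialization covq (q e).
have [she hs _] := tsh _ We; have [_ cs _] := hs _ We.
have nW : nbhs (q e) W by exact: open_nbhs_nbhs.
have nN : nbhs (q e) (W `&` sh e @^-1` U).
  by apply: filterI => //; apply: cs; rewrite she.
have nq : \forall e' \near e, exists g : I -> B,
    [/\ continuous g, g zero = q e, g one = q e' & forall s, (W `&` sh e @^-1` U) (g s)].
  exact: (@covering_continuous _ _ _ covq e _ (wB _ _ nN)).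
have ns := near_sheet_section covq oW tsh We.
apply: filterS2 nq ns => e' [g [cg g0 g1 gN]] [We' she'].
exists (fun s => sh e (g s)); split.
- by apply: (sheet_lift_continuous tsh) => // s; have [] := gN s.
- by rewrite g0.
- by rewrite g1.
- by move=> s; have [] := gN s.
Qed.

Lemma pathwise_connected (T : topologicalType) :
  (forall x y : T, inhabited {path I from x to y}) -> connected [set: T].
Proof.
move=> pT D [b Db] [O oO]; rewrite setTI => DO [C cC]; rewrite setTI => DC.
apply/seteqP; split => // t _; have [g] := pT b t.
suff e : D (g zero) = D (g one) by rewrite path_zero path_one in e; rewrite -e.
apply: (locally_constant_connected (h := fun s => D (g s))).
  exact: connected_unit_interval.
move=> s; have cg := @path_continuous _ _ _ _ g s.
have [Ds|nDs] := pselect (D (g s)).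
  have nD : nbhs (g s) D by apply: open_nbhs_nbhs; split => //; rewrite DO.
  have n : \forall s' \near s, D (g s') by exact: (cg _ nD).
  by apply: filterS n => s' Ds'; apply/propext.
have nD : nbhs (g s) (~` D).
  by apply: open_nbhs_nbhs; split => //; rewrite DC; exact: closed_openC.
have n : \forall s' \near s, ~ D (g s') by exact: (cg _ nD).
by apply: filterS n => s' nDs'; apply/propext.
Qed.

(** With [b'] the reverse of [b], the chain is [a ~ a (b' b) ~ (a b') b ~ b]. *)
Lemma simply_connected_homotopic (T : topologicalType) (x y : T)
    (a b : {path I from x to y}) : simply_connected R T -> homotopic a b.
Proof.
move=> [_ _ triv].
have loop (c : {path I from x to x}) : homotopic c (cst x).
  by apply/pi1_classP; exact: triv.
have loopy (c : {path I from y to y}) : homotopic c (cst y).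
  by apply/pi1_classP; exact: triv.
apply: homotopic_trans (homotopic_sym (concat_cst a)) _.
apply: homotopic_trans (homotopic_concat (homotopic_refl a)
  (homotopic_sym (loopy (concat (reverse b) b)))) _.
apply: homotopic_trans (concatA _ _ _) _.
apply: homotopic_trans (homotopic_concat (loop _) (homotopic_refl b)) _.
exact: cst_concat.
Qed.

Section Lifting.
Context (E B T : topologicalType) (q : E -> B) (g : T -> B) (t0 : T) (e0 : E).
Hypotheses (covq : covering_map q) (scT : simply_connected R T).
Hypotheses (wT : weakly_locally_path_connected R T).
Hypotheses (cg : continuous g) (qe0 : q e0 = g t0).

(** The graph of the lift to be constructed. Path lifting makes it total, and simple connectedness
    with monodromy makes it single-valued. *)
Let reaches (t : T) (e : E) := exists (a : I -> T) (b : I -> E),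
  [/\ continuous a, continuous b, a zero = t0 & a one = t] /\
  [/\ forall s, q (b s) = g (a s), b zero = e0 & b one = e].

Let reaches_unique t e e' : reaches t e -> reaches t e' -> e = e'.
Proof.
move=> [a [b [[ca cb a0 a1] [qb b0 <-]]]] [a' [b' [[ca' cb' a0' a1'] [qb' b0' <-]]]].
have [H [cH Ha Hb]] := simply_connected_homotopic
  (mk_path ca a0 a1) (mk_path ca' a0' a1') scT.
apply: (monodromy covq (H := g \o H)) => //.
- exact: (comp_continuous cH cg).
- by move=> t' /=; rewrite !(Hb _).1.
- by move=> t' /=; rewrite !(Hb _).2.
- by move=> s /=; rewrite (Ha s).1.
- by move=> s /=; rewrite (Ha s).2.
- by rewrite b0.
Qed.

(** Over an evenly covered set the lift is given by a sheet, since a path can be prolonged there by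
    lifting through the sheet. This is the source of continuity of the lift. *)
Let concat_reaches t e (U : set B) sheet t' (a : I -> T) :
  trivialization q U sheet -> U (q e) -> reaches t e ->
  continuous a -> a zero = t -> a one = t' -> (forall s, U (g (a s))) ->
  reaches t' (sheet e (g t')).
Proof.
move=> tsh Ue [a1 [b1 [[ca1 cb1 a10 a11] [qb1 b10 b11]]]] ca a0 a1' Ua.
have cb : continuous (fun s => sheet e (g (a s))).
  apply: (sheet_lift_continuous tsh) => //; exact: (comp_continuous ca cg).
have [she hs _] := tsh _ Ue.
have b0 : sheet e (g (a zero)) = e by rewrite a0 -a11 -qb1 b11.
exists (concat (mk_path ca1 a10 a11) (mk_path ca a0 a1')).
exists (concat (mk_path cb1 b10 b11) (mk_path cb b0 erefl)).
split; split; rewrite ?path_zero ?path_one ?a1' //; try exact: path_continuous.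
move=> s; rewrite !concatE; case: ifP => _; first exact: qb1.
by rewrite /mk_path; have [] := hs _ (Ua (clamp (2 * ival s - 1))).
Qed.

Lemma lifting_exists :
  exists G : T -> E, [/\ continuous G, forall t, q (G t) = g t & G t0 = e0].
Proof.
have [_ pT _] := scT.
have /choice[G hG] : forall t, exists e, reaches t e.
  move=> t; have [a] := pT t0 t.
  have [||b [cb qb b0]] := path_lift covq (g := g \o a) (e0 := e0).
  - exact: (@comp_continuous _ _ _ g a (@path_continuous _ _ _ _ a) cg).
  - by rewrite /= path_zero.
  exists (b one); exists a, b; split; split => //.
  - exact: path_continuous.
  - exact: path_zero.
  - exact: path_one.
exists G; split.
- move=> t; have [U [sh [oU Ut tsh]]] := covering_trivialization covq (g t).
  have qG : q (G t) = g t.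
    by have [a [b [[_ _ _ <-] [qb _ <-]]]] := hG t.
  have Ue : U (q (G t)) by rewrite qG.
  have nU : nbhs (g t) U by exact: open_nbhs_nbhs.
  have nT := wT (@cg t _ nU : nbhs t (fun t' => U (g t'))).
  have [she hs _] := tsh _ Ue; have [_ csh _] := hs _ Ut.
  move=> N nN; have nN' : nbhs (sh (G t) (g t)) N by rewrite -qG she.
  have n1 : \forall t' \near t, N (sh (G t) (g t')).
    exact: (continuous_comp (@cg t) csh nN').
  apply: filterS2 nT n1 => t' [a [ca a0 a1 Ua]].
  suff <- : G t' = sh (G t) (g t') by [].
  by apply: reaches_unique (hG t') _; exact: (concat_reaches tsh Ue (hG t) ca).
- by move=> t; have [a [b [[_ _ _ <-] [qb _ <-]]]] := hG t.
- apply: reaches_unique (hG t0) _; exists (cst t0), (cst e0).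
  by split; split => //; exact: cst_continuous.
Qed.

End Lifting.

End SimplyConnected.

(** * Universal covers *)

Lemma deck_transformation_cover (E X : topologicalType) (p : E -> X) g u :
  deck_transformation p g -> p (g u) = p u.
Proof. by move=> [h [_ _ _ _ pg]]; rewrite -[in RHS]pg. Qed.

Section UniversalCovers.
Context (R : realType).
Local Notation I := (unit_interval R).

Lemma simply_connected_connected (T : topologicalType) :
  simply_connected R T -> connected [set: T].
Proof. by move=> [_ pT _]; exact: pathwise_connected pT. Qed.

(** [p] is lifted through itself, once taking [e] to [e'] and once back. The two composites lift [p]
    and fix a point, so both are the identity. *)
Lemma deck_transformation_transitive (E X : topologicalType) (p : E -> X) e e' :
  universal_cover R p -> weakly_locally_path_connected R E -> p e = p e' ->
  exists2 g, deck_transformation p g & g e = e'.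
Proof.
move=> [covp scE] wE pe.
have cp := covering_continuous covp.
have [g [cg pg ge]] := lifting_exists covp scE wE cp (esym pe).
have [h [ch ph he]] := lifting_exists covp scE wE cp pe.
have cE := simply_connected_connected scE.
have cid : continuous (@id E) by move=> ?; exact: cvg_id.
exists g => //; exists h; split => //.
- move=> u; apply: (lift_unique covp (g1 := h \o g) cE (comp_continuous cg ch) cid
    _ (t0 := e)) => [t|] /=; by rewrite ?ph ?pg ?ge ?he.
- move=> u; apply: (lift_unique covp (g1 := g \o h) cE (comp_continuous ch cg) cid
    _ (t0 := e')) => [t|] /=; by rewrite ?pg ?ph ?he ?ge.
- by apply/funext.
Qed.

Section LiftedMap.
Context (X Y Xt Yt : topologicalType) (f : continuousType X Y).
Context (p : Xt -> X) (q : Yt -> Y) (F : Xt -> Yt).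
Hypotheses (ucp : universal_cover R p) (ucq : universal_cover R q).
Hypotheses (cF : continuous F) (qF : forall u, q (F u) = f (p u)).

(** Equivariance of [F] in terms of deck transformations: [h] is chosen to match at the single point
    [u0], and then [F \o g] and [h \o F] are lifts of the same map that agree there. *)
Lemma lifted_map_deck g : weakly_locally_path_connected R Yt ->
  deck_transformation p g ->
  exists2 h, deck_transformation q h & forall u, F (g u) = h (F u).
Proof.
move=> wY dg; have [covq scY] := ucq; have [covp scX] := ucp.
have [[u0 _] _ _] := scX.
have [|h dh hF] := deck_transformation_transitive ucq wY (e := F u0) (e' := F (g u0)).
  by rewrite !qF (deck_transformation_cover _ dg).
have [_ [cg _ _ _ _]] := dg; have [_ [ch _ _ _ _]] := dh.
exists h => //; apply: (lift_unique covq (simply_connected_connected scX)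
  (comp_continuous cg cF) (comp_continuous cF ch) _ (t0 := u0)) => [u|//].
by rewrite (deck_transformation_cover _ dh) !qF (deck_transformation_cover _ dg).
Qed.

Hypothesis pi1f : pi1_isomorphism R f.

(** A path from [u] to [v] projects to a loop [a]. Its image under [f] lifts to a loop in the simply
    connected [Yt], hence is null-homotopic; by injectivity on fundamental groups so is [a], and its
    lift must close up. *)
Lemma lifted_map_fiber_inj u v : p u = p v -> F u = F v -> u = v.
Proof.
move=> pe Fe; have [covp [_ pX _]] := ucp; have [covq scY] := ucq.
have [g] := pX u v.
have cg := @path_continuous _ _ _ _ g.
have cpg : continuous (p \o g).
  exact: (@comp_continuous _ _ _ p g cg (covering_continuous covp)).
have pg0 : (p \o g) zero = p u by rewrite /= path_zero.
have pg1 : (p \o g) one = p u by rewrite /= path_one.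
pose a : {path I from p u to p u} := mk_path cpg pg0 pg1.
have fa : homotopic (f \o a : {path I from f (p u) to f (p u)})
    (cst (f (p u)) : {path I from f (p u) to f (p u)}).
  have cFg : continuous (F \o g) := @comp_continuous _ _ _ F g cg cF.
  have Fg0 : (F \o g) zero = F u by rewrite /= path_zero.
  have Fg1 : (F \o g) one = F u by rewrite /= path_one.
  have [H [cH Ha Hb]] := simply_connected_homotopic
    (mk_path cFg Fg0 Fg1) (cst (F u)) scY.
  exists (q \o H); split.
  - exact: (comp_continuous cH (covering_continuous covq)).
  - by move=> s /=; rewrite (Ha s).1 (Ha s).2 /= !qF.
  - by move=> s /=; rewrite (Hb s).1 (Hb s).2 qF.
have : pi1_class a = pi1_class (cst (p u)).
  apply: (bij_inj (pi1f (p u))); rewrite !pi1_mapE; apply/pi1_classP.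
  apply: homotopic_trans fa _.
  suff -> : (f \o cst (p u) : {path I from f (p u) to f (p u)}) =
      (cst (f (p u)) : {path I from f (p u) to f (p u)}) by exact: homotopic_refl.
  exact/path_eqP.
move=> /pi1_classP[H [cH Ha Hb]].
have : g one = cst u (one : I); last by rewrite path_one.
apply: (monodromy covp cH (g1 := g) (g2 := cst u)) => //.
- by move=> t; rewrite !(Hb _).1.
- by move=> t; rewrite !(Hb _).2.
- exact: cst_continuous.
- by move=> s; rewrite (Ha s).1.
- by move=> s; rewrite (Ha s).2.
- by rewrite path_zero.
Qed.

(** A path from [F u0] to [w] projects to a loop, which is homotopic to the image of some loop [l]
    by surjectivity on fundamental groups. The endpoint of the lift of [l] from [u0] is the required
    point. *)
Lemma lifted_map_fiber_surj u0 w : q w = f (p u0) ->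
  exists2 u, p u = p u0 & F u = w.
Proof.
move=> qw; have [covp _] := ucp; have [covq [_ pY _]] := ucq.
have [d] := pY (F u0) w.
have cd := @path_continuous _ _ _ _ d.
have cqd : continuous (q \o d).
  exact: (@comp_continuous _ _ _ q d cd (covering_continuous covq)).
have qd0 : (q \o d) zero = f (p u0) by rewrite /= path_zero qF.
have qd1 : (q \o d) one = f (p u0) by rewrite /= path_one.
pose b : {path I from f (p u0) to f (p u0)} := mk_path cqd qd0 qd1.
have [k _ fk] := pi1f (p u0).
have [l kl] : exists l : {path I from p u0 to p u0}, pi1_class l = k (pi1_class b).
  by elim/pi1_ind: (k _) => l; exists l.
have : pi1_class (f \o l : {path I from f (p u0) to f (p u0)}) = pi1_class b.
  by rewrite -pi1_mapE kl fk.
move=> /pi1_classP[H [cH Ha Hb]].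
have [||G [cG pG G0]] := path_lift covp (g := l) (e0 := u0).
- exact: path_continuous.
- by rewrite path_zero.
exists (G one); first by rewrite pG path_one.
have : (F \o G) one = d one; last by rewrite path_one.
apply: (monodromy covq cH) => //.
- by move=> t; rewrite !(Hb _).1.
- by move=> t; rewrite !(Hb _).2.
- exact: (comp_continuous cG cF).
- by move=> s /=; rewrite (Ha s).1 /= qF pG.
- by move=> s; rewrite (Ha s).2.
- by rewrite /= G0 path_zero.
Qed.

End LiftedMap.
End UniversalCovers.

(** * CW complexes *)

Lemma within_closed_preimage (S T : topologicalType) (A : set S) (h : S -> T)
    (K : set T) :
  closed A -> {within A, continuous h} -> closed K -> closed (A `&` h @^-1` K).
Proof.
move=> cA /continuous_closedP ch cK.
have /closed_subspaceP[V cV VE] := ch _ cK.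
by rewrite setIC -VE; apply: closedI.
Qed.

Lemma within_continuous_closed (S T : topologicalType) (A : set S) (h : S -> T) :
  (forall K, closed K -> closed (A `&` h @^-1` K)) -> {within A, continuous h}.
Proof.
move=> ch; apply/continuous_closedP => K cK; apply/closed_subspaceP.
exists (A `&` h @^-1` K); first exact: ch.
by apply/seteqP; split => x /= [] // [].
Qed.

Lemma within_comp_continuous (S T U : topologicalType) (A : set T) (h : S -> T)
    (k : T -> U) : continuous h -> (forall s, A (h s)) ->
  {within A, continuous k} -> continuous (k \o h).
Proof.
move=> ch Ah /subspace_continuousP ck s N nN.
have nA : nbhs (h s) (fun t => A t -> N (k t)) := ck _ (Ah s) _ nN.
have n : \forall s' \near s, A (h s') -> N (k (h s')) by exact: (ch s _ nA).
by apply: filterS n => s'; apply.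
Qed.

Section Discs.
Context (R : realType) (n : nat).

Lemma sqnorm_continuous : continuous (@sqnorm R n).
Proof.
apply: continuous_big => [|i _]; first exact: add_continuous.
have cc : continuous (fun v : 'rV[R]_n => v 0 i) by exact: coord_continuous.
by move=> v; exact: (cvgM (cc v) (cc v)).
Qed.

Lemma closed_disc_closed : closed (@closed_disc R n).
Proof.
have := @closed_comp _ _ (@sqnorm R n) [set r | r <= 1].
apply; last exact: closed_le.
by move=> v _; exact: sqnorm_continuous.
Qed.

Lemma unit_sphere_closed : closed (@unit_sphere R n).
Proof.
have := @closed_comp _ _ (@sqnorm R n) [set 1].
apply; last exact: closed_eq.
by move=> v _; exact: sqnorm_continuous.
Qed.

Lemma closed_disc_compact : compact (@closed_disc R n).
Proof.
apply: bounded_closed_compact; last exact: closed_disc_closed.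
exists 1; split => // r r1 v vD.
(* Row vectors carry the maximum norm, which the Euclidean norm defining the disc dominates. *)
rewrite /= [leLHS]/Num.Def.normr /= mx_normrE; apply: bigmax_le => [|[i j] _ /=]; first lra.
rewrite (ord1 i) (le_trans _ (ltW r1)) // -ler_sqr ?nnegrE // expr1n.
apply: le_trans vD; rewrite /sqnorm (bigD1 j) //= real_normK ?num_real //.
by rewrite lerDl sumr_ge0 // => k _; rewrite sqr_ge0.
Qed.

Lemma closed_disc_convex (u v : 'rV[R]_n) (t : R) : 0 <= t <= 1 ->
  closed_disc u -> closed_disc v -> closed_disc (u + t *: (v - u)).
Proof.
move=> /andP[t0 t1] uD vD.
apply: (@le_trans _ _ ((1 - t) * sqnorm u + t * sqnorm v)); last first.
  by rewrite /closed_disc /= in uD vD; nra.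
rewrite /sqnorm !mulr_sumr -big_split /=; apply: ler_sum => i _.
rewrite !mxE -subr_ge0.
have -> : (1 - t) * u 0 i ^+ 2 + t * v 0 i ^+ 2 -
    (u 0 i + t * (v 0 i - u 0 i)) ^+ 2 = t * (1 - t) * (v 0 i - u 0 i) ^+ 2.
  by ring.
by rewrite mulr_ge0 ?sqr_ge0 // mulr_ge0 // subr_ge0.
Qed.

End Discs.

Section CWComplexes.
Context (R : realType) (X : topologicalType) (cw : cw_structure R X).
Local Notation I := (unit_interval R).

(** The set [P] of points reachable inside the open set [O] is open. By the weak topology its
    complement can be tested in each closed disc, where convexity provides short straight
    segments. *)
Lemma cw_weakly_locally_path_connected : weakly_locally_path_connected R X.
Proof.
move=> x U /nbhs_interior; set O := interior U => nO.
pose P := [set y | exists a : I -> X,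
  [/\ continuous a, a zero = x, a one = y & forall s, O (a s)]].
have subP y : P y -> exists a : I -> X,
    [/\ continuous a, a zero = x, a one = y & forall s, U (a s)].
  by move=> [a [ca a0 a1 Oa]]; exists a; split => // s; exact: (@interior_subset _ U _ (Oa s)).
suff oP : open P.
  suff nP : nbhs x P by apply: filterS nP; exact: subP.
  apply: open_nbhs_nbhs; split => //; exists (cst x); split => //.
    exact: cst_continuous.
  by move=> s; exact: nbhs_singleton nO.
rewrite -closedC; apply/(cw_weak_topology cw) => c.
set D := @closed_disc R _; set Phi := @cell_map _ _ cw c.
move=> d cld; have Dd : D d.
  by apply: (@closed_disc_closed R (cell_dim c)); apply: closure_subset cld => ? [].
split => // -[a [ca a0 a1 Oa]].
have /subspace_continuousP /(_ d Dd) cPhi := cell_map_continuous (c := c).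
have nOd : nbhs (Phi d) O.
  by apply: open_nbhs_nbhs; split; [exact: open_interior|rewrite -a1; exact: Oa].
have nd : nbhs d (fun v => D v -> O (Phi v)) := cPhi _ nOd.
have /nbhs_ballP[e /= e0 He] := nd.
(* [v] is supposed unreachable yet arbitrarily close to the reachable [d]; the segment from [d] to
   [v] gives the contradiction. *)
have [v [[Dv nPv] dv]] := cld _ (nbhsx_ballx d _ e0).
apply: nPv; pose h (s : I) := d + ival s *: (v - d).
have hD s : D (h s) by apply: closed_disc_convex => //; exact: unit_interval_bounds.
have ch : continuous h.
  move=> s; apply: (@cvgD _ _ _ (nbhs s) _ (fun=> d) (fun s => ival s *: (v - d))).
    exact: cvg_cst.
  apply: (@cvgZ R 'rV[R]_(cell_dim c) I (nbhs s) _ (@ival R) (fun=> v - d)).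
    exact: (@ival_continuous R s).
  exact: cvg_cst.
have cPh : continuous (Phi \o h).
  exact: within_comp_continuous ch hD (cell_map_continuous (c := c)).
have P0 : (Phi \o h) zero = Phi d by rewrite /h /= ival_zero scale0r addr0.
have P1 : (Phi \o h) one = Phi v by rewrite /h /= ival_one scale1r addrC subrK.
exists (concat (mk_path ca a0 a1) (mk_path cPh P0 P1)).
split; rewrite ?path_zero ?path_one //; first exact: path_continuous.
move=> s; rewrite concatE; case: ifP => _; first exact: Oa.
rewrite /mk_path /=; apply: He => //; set t := clamp _.
have /andP[t0 t1] := unit_interval_bounds t.
case: dv => _ dv; split => // i j; have := dv i j; rewrite /ball /= !mxE => dvij.
have -> : d i j - (d i j + ival t * (v i j - d i j)) = ival t * (d i j - v i j).
  by ring.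
by rewrite normrM ger0_norm // (le_lt_trans _ dvij) // ler_piMl.
Qed.

(** * Complete regularity of CW complexes *)

Section Bump.
Variables (C : set X) (x0 : X).
Hypotheses (clC : closed C) (nCx : ~ C x0).
Local Notation Disc c := (@closed_disc R (cell_dim c)).
Local Notation Phi c := (@cell_map _ _ cw c).
Local Notation Cell c := (Phi c @` @open_disc R (cell_dim c)).

(** A bump function as far as discs of dimension below [k] are concerned. Keeping [g] total on [X]
    and asking continuity only after composition with the cell maps avoids treating skeleta as
    spaces. *)
Let good (k : nat) (g : X -> R) := [/\ g x0 = 1, forall x, C x -> g x = 0,
  forall x, `|g x| <= 1 & forall c : cell cw, (cell_dim c < k)%N ->
    {within Disc c, continuous (g \o Phi c)}].

Let open_cell_disjoint (c c' : cell cw) x : Cell c x -> Cell c' x -> c = c'.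
Proof.
by move=> cx c'x; have [d [_ du]] := cell_partition cw x; rewrite -(du c) // -(du c').
Qed.

Let disc_split n (v : 'rV[R]_n) : closed_disc v -> open_disc v \/ unit_sphere v.
Proof.
by rewrite /closed_disc /= le_eqVlt => /orP[/eqP|]; [right|left].
Qed.

Let closed_disc_cells (c : cell cw) v : closed_disc v ->
  exists c', (cell_dim c' <= cell_dim c)%N /\ Cell c' (Phi c v).
Proof.
move=> /disc_split[vo|vs]; first by exists c; split => //; exists v.
have [F [_ Fd FS]] := cw_closure_finite c.
have [|c' Fc' c'v] := FS (Phi c v); first by exists v.
by exists c'; split => //; apply/ltnW/Fd.
Qed.

Let closed_x0 : closed [set x0].
Proof.
exact/accessible_closed_set1/hausdorff_accessible/(cw_hausdorff cw).
Qed.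

Let closed_disc_pre (c : cell cw) (K : set X) : closed K ->
  closed (Disc c `&` Phi c @^-1` K).
Proof.
move=> cK; apply: within_closed_preimage => //; first exact: closed_disc_closed.
exact: cell_map_continuous.
Qed.

(** By closure finiteness the boundary of the cell meets finitely many lower cells. The part of
    their closed cells where [g] lies in [K] is a finite union of compact sets, closed as [X] is
    Hausdorff, so its preimage in the disc is closed. *)
Let good_sphere k g (c : cell cw) : good k g -> cell_dim c = k ->
  {within @unit_sphere R (cell_dim c), continuous (g \o Phi c)}.
Proof.
move=> [_ _ _ cg] ck; apply: within_continuous_closed => K cK.
have [F [finF Fd FS]] := cw_closure_finite c.
pose Z := \bigcup_(c' in (F : set {classic (cell cw)}))
  (Phi c' @` (Disc c' `&` (g \o Phi c') @^-1` K)).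
have cZ : closed Z.
  apply: closed_bigcup => // c' Fc'; apply: (compact_closed (cw_hausdorff cw)).
  have sD : Disc c' `&` (g \o Phi c') @^-1` K `<=` Disc c' by move=> ? [].
  apply: continuous_compact.
    exact: continuous_subspaceW sD (@cell_map_continuous _ _ cw c').
  apply: subclosed_compact sD; last exact: closed_disc_compact.
  apply: within_closed_preimage => //; first exact: closed_disc_closed.
  by apply: cg; rewrite -ck; exact: Fd.
have -> : unit_sphere (n := cell_dim c) `&` (g \o Phi c) @^-1` K =
    unit_sphere (n := cell_dim c) `&` (Disc c `&` Phi c @^-1` Z).
  apply/seteqP; split => v [vs].
    move=> Kv; split => //; split; first by rewrite /closed_disc /= vs.
    have [|c' Fc' [w wo we]] := FS (Phi c v); first by exists v.
    exists c' => //; exists w => //; split; first exact: ltW.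
    by rewrite /= we.
  by move=> [_ [c' _ [w [_ wK] we]]]; split => //; rewrite /= -we.
by apply: closedI; [exact: unit_sphere_closed|exact: closed_disc_pre].
Qed.

(** Tietze extension inside the disc. The closed set [A] contains, besides the sphere, the preimages
    of [C] and [x0], so the extension keeps the prescribed values 0 and 1 in the interior. *)
Let good_cell k g (c : cell cw) : good k g -> cell_dim c = k ->
  exists h : 'rV[R]_(cell_dim c) -> R, [/\ continuous h,
    forall v, unit_sphere v -> h v = g (Phi c v),
    forall v, closed_disc v -> C (Phi c v) -> h v = 0,
    forall v, closed_disc v -> Phi c v = x0 -> h v = 1 &
    forall v, `|h v| <= 1].
Proof.
move=> gk ck; have [g1 gC gb cg] := gk.
pose A := unit_sphere (n := cell_dim c) `|`
  (Disc c `&` Phi c @^-1` C `|` Disc c `&` Phi c @^-1` [set x0]).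
have cst_within (K : set X) r : (forall x, K x -> g x = r) ->
    {within Disc c `&` Phi c @^-1` K, continuous (g \o Phi c)}.
  move=> gK; apply: (subspace_eq_continuous (f := cst r)) => [v|].
    by rewrite inE => -[_ Kv]; exact/esym/gK.
  exact/continuous_subspaceT/cst_continuous.
have cA : {within A, continuous (g \o Phi c)}.
  apply: withinU_continuous; [exact: unit_sphere_closed| |exact: good_sphere gk ck|].
    by apply: closedU; exact: closed_disc_pre.
  apply: withinU_continuous; try exact: closed_disc_pre; first exact: (cst_within _ 0).
  by apply: (cst_within _ 1) => x ->.
have clA : closed A.
  by apply: closedU; [exact: unit_sphere_closed|apply: closedU; exact: closed_disc_pre].
have [h [hA ch hb]] := numfun.continuous_bounded_extension
  (@pseudometric_normal R 'rV[R]_(cell_dim c)) clA (M := 1) (f := g \o Phi c)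
  ltr01 cA (fun v _ => gb _).
exists h; split => //.
- by move=> v vs; rewrite -hA // inE; left.
- by move=> v vD vC; rewrite -hA /= ?gC // inE; right; left.
- by move=> v vD vx; rewrite -hA /= ?vx // inE; right; right.
Qed.

Let Phi_inj (c : cell cw) v w : open_disc v -> open_disc w ->
  Phi c v = Phi c w -> v = w.
Proof.
move=> vo wo; have [[_ inj _] _ _] := @cell_map_homeomorphism _ _ cw c.
by apply: inj; rewrite inE.
Qed.

Let good_step k g : good k g -> exists g', good k.+1 g' /\
  forall c x, (cell_dim c < k)%N -> Cell c x -> g' x = g x.
Proof.
move=> gk; have [g1 gC gb cg] := gk.
pose extends (c : cell cw) (h : 'rV[R]_(cell_dim c) -> R) :=
  [/\ continuous h, forall v, unit_sphere v -> h v = g (Phi c v),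
    forall v, closed_disc v -> C (Phi c v) -> h v = 0,
    forall v, closed_disc v -> Phi c v = x0 -> h v = 1 &
    forall v, `|h v| <= 1].
(* The type of the extension depends on the cell, hence extraction by [cid] below; the zero function
   is a default for cells of other dimensions. *)
have Hh (c : cell cw) : exists h, cell_dim c = k -> extends c h.
  have [ck|nck] := pselect (cell_dim c = k); last by exists (cst 0).
  by have [h hP] := good_cell gk ck; exists h.
pose h c := projT1 (cid (Hh c)).
have hP c : cell_dim c = k -> extends c (h c) := projT2 (cid (Hh c)).
(* The new function follows [h] on the open cells of dimension [k] and equals [g] on all others.
   Describing the value by a relation avoids transporting vectors along equalities of cells. *)
have /choice[g' g'P] : forall x, exists r,
    (forall c v, cell_dim c = k -> open_disc v -> Phi c v = x -> r = h c v) /\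
    ((forall c : cell cw, cell_dim c = k -> ~ Cell c x) -> r = g x).
  move=> x; have [[c [ck [v vo vx]]]|nc] :=
      pselect (exists c : cell cw, cell_dim c = k /\ Cell c x).
    exists (h c v); split=> [c' v' ck' vo' vx'|/(_ c ck)[]]; last by exists v.
    have cc' : c = c' by apply: (@open_cell_disjoint _ _ x); [exists v|exists v'].
    by subst c'; congr (h c _); apply: Phi_inj => //; rewrite vx.
  exists (g x); split => // c v ck vo vx; case: nc; exists c; split => //.
  by exists v.
have g'low c x : cell_dim c <> k -> Cell c x -> g' x = g x.
  move=> ck cx; have [_] := g'P x; apply => c' ck' c'x; apply: ck.
  by rewrite (open_cell_disjoint cx c'x).
have g'disc c v : cell_dim c = k -> closed_disc v -> g' (Phi c v) = h c v.
  move=> ck /disc_split[vo|vs]; first by have [H _] := g'P (Phi c v); exact: H.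
  have [_ hs _ _ _] := hP c ck; rewrite hs //.
  have [F [_ Fd FS]] := cw_closure_finite c.
  have [|c' Fc' c'v] := FS (Phi c v); first by exists v.
  apply: (g'low c') => // e; have := Fd _ Fc'.
  by rewrite e ck ltnn.
have cases x : (exists c, cell_dim c = k /\ exists2 v, open_disc v & Phi c v = x)
    \/ g' x = g x.
  have [c [[v vo vx] _]] := cell_partition cw x.
  have [ck|nck] := pselect (cell_dim c = k); first by left; exists c; split => //; exists v.
  by right; apply: (g'low c) => //; exists v.
exists g'; split; last by move=> c x ck; apply: g'low => e; rewrite e ltnn in ck.
split.
- have [[c [ck [v vo vx]]]|->//] := cases x0.
  rewrite -{1}vx g'disc //; last exact: ltW.
  by have [_ _ _ -> //] := hP c ck; exact: ltW.
- move=> x Cx; have [[c [ck [v vo vx]]]|->] := cases x; last exact: gC.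
  rewrite -vx g'disc //; last exact: ltW.
  by have [_ _ -> //] := hP c ck; [exact: ltW|rewrite vx].
- move=> x; have [[c [ck [v vo vx]]]|->//] := cases x.
  rewrite -vx g'disc //; last exact: ltW.
  by have [_ _ _ _] := hP c ck.
- move=> c; rewrite ltnS leq_eqVlt => /orP[/eqP ck|ck].
    have [ch _ _ _ _] := hP c ck.
    apply: (subspace_eq_continuous (f := h c)); last exact: continuous_subspaceT.
    by move=> v; rewrite inE => vD; exact/esym/g'disc.
  apply: (subspace_eq_continuous (f := g \o Phi c)); last exact: cg.
  move=> v; rewrite inE => /closed_disc_cells[c' [c'c c'v]]; apply/esym/(g'low c') => // e.
  by rewrite e leqNgt ck in c'c.
Qed.

Lemma cw_bump : exists b : X -> R, [/\ continuous b, b x0 = 1,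
  forall x, C x -> b x = 0 & forall x, `|b x| <= 1].
Proof.
have /choice[next nextP] : forall kg : nat * (X -> R), exists g', good kg.1 kg.2 ->
    good kg.1.+1 g' /\
    forall c x, (cell_dim c < kg.1)%N -> Cell c x -> g' x = kg.2 x.
  move=> [k g]; have [gk|nk] := pselect (good k g); last by exists g.
  by have [g' g'P] := good_step gk; exists g'.
(* The indicator function of [x0] is an admissible start, since at stage 0 the continuity clause
   concerns no disc. *)
pose G := fix G k := if k is k'.+1 then next (k', G k') else fun x => (x == x0)%:R.
have goodG k : good k (G k).
  elim: k => [|k IH] /=; last by have [] := nextP (k, G k) IH.
  split => //.
  - by rewrite eqxx.
  - by move=> x Cx; case: eqP => // xx; case: nCx; rewrite -xx.
  - by move=> x; rewrite ger0_norm ?ler0n // lern1 leq_b1.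
have G_stable c x k : (cell_dim c < k)%N -> Cell c x ->
    G k x = G (cell_dim c).+1 x.
  move=> + cx; elim: k => // k IH; rewrite ltnS leq_eqVlt => /orP[/eqP->//|ck].
  by have [_ /(_ c x ck cx) /= ->] := nextP (k, G k) (goodG k); exact: IH.
have /choice[cellof cellofP] : forall x, exists c, Cell c x.
  by move=> x; have [c [cx _]] := cell_partition cw x; exists c.
pose b x := G (cell_dim (cellof x)).+1 x.
have bE c x : Cell c x -> b x = G (cell_dim c).+1 x.
  by move=> cx; rewrite /b (open_cell_disjoint (cellofP x) cx).
have bG x : exists k, b x = G k x by exists (cell_dim (cellof x)).+1.
exists b; split.
- apply/continuous_closedP => K cK; apply/(cw_weak_topology cw) => c.
  apply: within_closed_preimage cK; first exact: closed_disc_closed.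
  (* A closed disc meets only cells of at most its own dimension, on which the construction has
     stabilized by this stage. *)
  apply: (subspace_eq_continuous (f := G (cell_dim c).+1 \o Phi c)).
    move=> v; rewrite inE => /closed_disc_cells[c' [c'c c'v]].
    by have := bE _ _ c'v; rewrite -(G_stable c' _ (cell_dim c).+1 _ c'v) // => /esym.
  by have [_ _ _] := goodG (cell_dim c).+1; apply.
- by have [k ->] := bG x0; have [] := goodG k.
- by move=> x Cx; have [k ->] := bG x; have [_ ->] := goodG k.
- by move=> x; have [k ->] := bG x; have [_ _ ->] := goodG k.
Qed.

End Bump.
End CWComplexes.

(** * Transport of sections along fibrewise bijections *)

Section PointwiseTopology.
Context (I : Type) (V : topologicalType).

Lemma ptws_continuous_at (S : topologicalType) (h : S -> {ptws I -> V}) s :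
  (forall i, {for s, continuous (fun s => h s i)}) -> {for s, continuous h}.
Proof.
move=> ch; apply/cvg_sup => i N [_ [[W oW <-] Ws sub]].
have n : \forall s' \near s, W (h s' i).
  by apply: (ch i); exact: open_nbhs_nbhs.
by apply: filterS n => s' Ws'; exact: sub.
Qed.

Lemma ptws_eval_continuous i : continuous (fun u : {ptws I -> V} => u i).
Proof.
move=> u N nN; have /cvg_sup/(_ i) : u --> u by apply: cvg_id.
apply; exists [set v | N° (v i)]; split => //.
  by exists N°; [exact: open_interior|].
by move=> v; exact: interior_subset.
Qed.

End PointwiseTopology.

Section FiniteSums.
Context (R : realType) (Z : choiceType).
Implicit Types g h : Z -> R.

Lemma fsum_seq g (s : seq Z) : uniq s -> (forall z, g z != 0 -> z \in s) ->
  \sum_(z \in [set: Z]) g z = \sum_(z <- s) g z.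
Proof.
move=> us gs; rewrite (fsbigE s) //; first by apply: eq_bigl => z; rewrite in_setT.
by move=> z _; apply: contraNeq; exact: gs.
Qed.

Lemma fsum_single g z0 : (forall z, g z != 0 -> z = z0) ->
  \sum_(z \in [set: Z]) g z = g z0.
Proof.
move=> gz; rewrite (@fsum_seq _ [:: z0]) // ?big_seq1 // => z /gz ->.
by rewrite inE.
Qed.

(** The list [t] certifies finite support; a sum of infinite support is 0 by convention, and the
    bound could fail. *)
Lemma seq_le_fsum g (s t : seq Z) : (forall z, 0 <= g z) ->
  (forall z, g z != 0 -> z \in t) -> uniq s ->
  \sum_(z <- s) g z <= \sum_(z \in [set: Z]) g z.
Proof.
move=> g0 gt us; have uu := undup_uniq (s ++ t).
have -> : \sum_(z <- s) g z =
    \sum_(z \in [set: Z]) (if z \in s then g z else 0).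
  rewrite (fsum_seq us) => [|z]; first by apply: eq_big_seq => z ->.
  by case: ifP; rewrite ?eqxx.
rewrite !(fsum_seq uu); first by apply: ler_sum => z _; case: ifP.
- by move=> z /gt zt; rewrite mem_undup mem_cat zt orbT.
- by move=> z; case: ifP => [zs _|_ /eqP//]; rewrite mem_undup mem_cat zs.
Qed.

End FiniteSums.

Lemma near_all_seq (T : topologicalType) (C : eqType) (s : seq C) (x : T)
    (P : C -> T -> Prop) : (forall c, c \in s -> \forall y \near x, P c y) ->
  \forall y \near x, forall c, c \in s -> P c y.
Proof.
elim: s => [|c s IH] h; first by apply: nearW.
have n1 := h c (mem_head _ _).
have n2 : \forall y \near x, forall c, c \in s -> P c y.
  by apply: IH => d ds; apply: h; rewrite inE ds orbT.
apply: filterS2 n1 n2 => y h1 h2 d; rewrite inE => /orP[/eqP->//|]; exact: h2.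
Qed.

Lemma near_forall (T : topologicalType) (C : finType) (x : T) (P : C -> T -> Prop) :
  (forall c, \forall y \near x, P c y) -> \forall y \near x, forall c, P c y.
Proof.
move=> h; have := near_all_seq (s := enum C) (fun c _ => h c).
by apply: filterS => y hy c; apply: hy; rewrite mem_enum.
Qed.

Section Pullback.
Context (R : realType) (E B E' B' : topologicalType).
Context (r : E -> B) (r' : E' -> B') (Fb : E -> E') (fb : B -> B') (n : nat).
Hypotheses (cFb : continuous Fb) (cfb : continuous fb).
Hypothesis rF : forall e, r' (Fb e) = fb (r e).
Hypothesis Fb_inj : forall e1 e2, r e1 = r e2 -> Fb e1 = Fb e2 -> e1 = e2.
Hypothesis Fb_surj : forall x e', r' e' = fb x -> exists2 e, r e = x & Fb e = e'.
Hypothesis local_section : forall e, exists sigma : B -> E,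
  [/\ {for r e, continuous sigma}, sigma (r e) = e &
      \forall x \near r e, r (sigma x) = x].
Hypothesis fiber_bump : forall e', exists psi : bounded_continuous R E',
  sval psi e' <> 0 /\ forall e1 e2, r' e1 = r' e2 ->
    sval psi e1 <> 0 -> sval psi e2 <> 0 -> e1 = e2.

Variable s : B' -> fiberwise (R := R) r' (n := n).
Hypotheses (cs : continuous s) (sK : cancel s (@fiberwise_map R E' B' r' n)).

Let nu (y : B') : nmeasure R E' n := set_val (s y).

Let nu_fiber y e' : nu y e' != 0 -> r' e' = y.
Proof.
by move=> h; rewrite -[RHS](sK y); exact: (projT2 (cid (set_valP (s y))) e' h).
Qed.

Let nu_continuous (psi : bounded_continuous R E') :
  continuous (fun y => \sum_(e' \in [set: E']) nu y e' * sval psi e').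
Proof.
have c0 : continuous (set_val : fiberwise (R := R) r' (n := n) -> nmeasure R E' n).
  exact: initial_continuous.
have c1 : continuous (@expectation R E' n) by exact: initial_continuous.
have c2 := comp_continuous (comp_continuous cs c0) c1.
have c3 := @ptws_eval_continuous (bounded_continuous R E') R psi.
by have := comp_continuous c2 c3.
Qed.

(** The measure over [fb x] pulled back along the bijection of fibres and extended by zero off the
    fibre over [x]. *)
Let w (x : B) (e : E) : R := if r e == x then nu (fb x) (Fb e) else 0.

Let w_ge0 x e : 0 <= w x e.
Proof. by rewrite /w; case: ifP => // _; exact: mass_ge0. Qed.

Let w_fiber x e : w x e != 0 -> r e = x /\ nu (fb x) (Fb e) != 0.
Proof. by rewrite /w; case: ifP => [/eqP|]; rewrite ?eqxx. Qed.

Let w_support x : (Defs.support (w x) #<= `I_n)%card.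
Proof.
apply: card_le_trans (mass_support (nu (fb x))).
have inj : set_inj (Defs.support (w x)) Fb.
  by move=> e1 e2; rewrite !inE => /w_fiber[e1x _] /w_fiber[e2x _]; apply: Fb_inj; rewrite e1x.
rewrite -(card_le_eql (inj_card_eq inj)); apply: subset_card_le.
by move=> _ [e /w_fiber[_ h] <-].
Qed.

Let fiber_bij x : set_bij (r @^-1` [set x]) (r' @^-1` [set fb x]) Fb.
Proof.
split.
- by move=> e /= <-.
- by move=> e1 e2; rewrite !inE /= => <- h; exact: Fb_inj.
- by move=> e' /= /Fb_surj[e re Fe]; exists e.
Qed.

Let w_total x : \sum_(e \in [set: E]) w x e = 1.
Proof.
rewrite -(mass_total (nu (fb x))).
rewrite -(fsbig_widen (r @^-1` [set x])) //; last first.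
  by move=> e [_ re]; rewrite /= /w; case: eqP.
rewrite -(fsbig_widen (r' @^-1` [set fb x]) [set: E']) //; last first.
  by move=> e' [_ re]; apply: contrapT => /eqP/nu_fiber.
rewrite (@reindex_fsbig _ _ _ E E' Fb _ _ _ (fiber_bij x)); apply: eq_fsbigr => e.
by rewrite inE /= /w => ->; rewrite eqxx.
Qed.

Let mu x : nmeasure R E n := NMeasure (w_ge0 x) (w_support x) (w_total x).

Let w_finite x : exists t : seq E, uniq t /\ forall e, w x e != 0 -> e \in t.
Proof.
have fin : finite_set (Defs.support (w x)).
  exact: card_le_finite (w_support x) (finite_II n).
have /finite_seqP[t tE] := fin.
exists (undup t); split; first exact: undup_uniq.
by move=> e h; have : Defs.support (w x) e by []; rewrite tE mem_undup.
Qed.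

(* A bump function isolating [Fb e] in its fibre recovers the weight carried by
   the local section through [e] as a quotient of continuous functions. *)
Let w_section_continuous x e sigma : r e = x -> {for x, continuous sigma} ->
  sigma x = e -> (\forall y \near x, r (sigma y) = y) ->
  {for x, continuous (fun y => w y (sigma y))}.
Proof.
move=> re csig sx nr.
have [psi [psie psi_inj]] := fiber_bump (Fb e).
have cpsi := (svalP psi).1.
have cden : {for x, continuous (fun y => sval psi (Fb (sigma y)))}.
  exact: (continuous_comp csig (comp_continuous cFb cpsi (x := _))).
have den0 : sval psi (Fb (sigma x)) != 0 by rewrite sx; apply/eqP.
have nden : \forall y \near x, sval psi (Fb (sigma y)) != 0.
  exact: (cvgr_neq0 _ cden den0).
have cnum := comp_continuous cfb (@nu_continuous psi).
have cquot : {for x, continuous (fun y =>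
    (\sum_(e' \in [set: E']) nu (fb y) e' * sval psi e') / sval psi (Fb (sigma y)))}.
  exact: (cvgM (cnum x) (cvgV den0 cden)).
have quotE y : r (sigma y) = y -> sval psi (Fb (sigma y)) != 0 ->
    (\sum_(e' \in [set: E']) nu (fb y) e' * sval psi e') / sval psi (Fb (sigma y))
    = w y (sigma y).
  move=> ry dy; rewrite (@fsum_single _ _ _ (Fb (sigma y))) => [|e'].
    by rewrite mulfK // /w ry eqxx.
  rewrite mulf_eq0 negb_or => /andP[/nu_fiber re' /eqP pe'].
  by apply: psi_inj => //; [rewrite re' rF ry|exact/eqP].
rewrite /prop_for /continuous_at -(quotE x) ?sx //; last by rewrite -sx.
rewrite -{1}sx.
apply: cvg_trans cquot; apply: near_eq_cvg.
by apply: filterS2 nr nden => y; exact: quotE.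
Qed.

(** [E] is not assumed Hausdorff; the bump isolating [Fb e1] in its fibre separates the two sections
    instead. *)
Let sections_separate x e1 e2 sigma1 sigma2 : r e1 = x -> r e2 = x -> e1 <> e2 ->
  {for x, continuous sigma1} -> {for x, continuous sigma2} ->
  sigma1 x = e1 -> sigma2 x = e2 ->
  \forall y \near x, sigma1 y <> sigma2 y.
Proof.
move=> r1 r2 e12 c1 c2 s1 s2.
have [psi [psie psi_inj]] := fiber_bump (Fb e1).
have cpsi := comp_continuous cFb (svalP psi).1.
have psi2 : sval psi (Fb e2) = 0.
  apply: contrapT => h; apply: e12; apply: Fb_inj; first by rewrite r1 r2.
  by apply: psi_inj => //; rewrite !rF r1 r2.
have cd1 : {for x, continuous (fun y => sval psi (Fb (sigma1 y)))}.
  exact: continuous_comp c1 (cpsi _).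
have cd2 : {for x, continuous (fun y => sval psi (Fb (sigma2 y)))}.
  exact: continuous_comp c2 (cpsi _).
have cd : {for x, continuous (fun y => sval psi (Fb (sigma1 y)) - sval psi (Fb (sigma2 y)))}.
  exact: continuousB cd1 cd2.
have d0 : sval psi (Fb (sigma1 x)) - sval psi (Fb (sigma2 x)) != 0.
  by rewrite s1 s2 psi2 subr0; exact/eqP.
have n1 : \forall y \near x, sval psi (Fb (sigma1 y)) - sval psi (Fb (sigma2 y)) != 0.
  exact: (cvgr_neq0 _ cd d0).
by apply: filterS n1 => y + e; rewrite e subrr eqxx.
Qed.

(** The atoms at [x] are followed along local sections; their contribution [D] is continuous at [x].
    Nearby measures may have further atoms, but these contribute nonnegatively, so [D] stays a lower
    bound. *)
Let lower_semicontinuous (phi : E -> R) x (eps : R) : continuous phi ->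
  (forall e, 0 <= phi e) -> 0 < eps ->
  \forall y \near x, \sum_(e \in [set: E]) w x e * phi e - eps
    < \sum_(e \in [set: E]) w y e * phi e.
Proof.
move=> cphi phi0 eps0.
have [t [ut tw]] := w_finite x.
pose t' := [seq e <- t | w x e != 0].
have ut' : uniq t' by exact: filter_uniq.
have rt' e : e \in t' -> r e = x by rewrite mem_filter => /andP[/w_fiber[]].
have /choice[sigma sigmaP] := local_section.
have nsec e : e \in t' -> \forall y \near x, r (sigma e y) = y.
  by move=> /rt' re; have [_ _] := sigmaP e; rewrite re.
have csec e : e \in t' -> {for x, continuous (sigma e)}.
  by move=> /rt' re; have [+ _ _] := sigmaP e; rewrite re.
have secx e : e \in t' -> sigma e x = e.
  by move=> /rt' re; have [_ + _] := sigmaP e; rewrite re.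
pose D y := \sum_(e <- t') w y (sigma e y) * phi (sigma e y).
have Dx : D x = \sum_(e \in [set: E]) w x e * phi e.
  rewrite (fsum_seq ut') => [|e].
    by apply: eq_big_seq => e et; rewrite secx.
  rewrite mulf_eq0 negb_or => /andP[h _]; rewrite mem_filter h; exact: tw.
have cD : {for x, continuous D}.
  have -> : D = fun y => \sum_(e <- t' | e \in t') w y (sigma e y) * phi (sigma e y).
    by apply/funext => y; rewrite /D big_seq.
  rewrite /prop_for /continuous_at /=.
  apply: cvg_big => [|e et]; first exact: add_continuous.
  apply: cvgM; last exact: continuous_comp (csec _ et) (cphi _).
  exact: (w_section_continuous (rt' _ et) (csec _ et) (secx _ et) (nsec _ et)).
have nD : \forall y \near x, D x - eps < D y.
  by apply: (cvgr_gt _ cD); rewrite ltrBlDr ltrDl.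
(* If two sections met at [y], the atom there would be counted twice in [D]. *)
have nsep : \forall y \near x, forall e1, e1 \in t' -> forall e2, e2 \in t' ->
    sigma e1 y = sigma e2 y -> e1 = e2.
  apply: near_all_seq => e1 et1; apply: near_all_seq => e2 et2.
  have [->|/eqP e12] := eqVneq e1 e2; first by apply: nearW.
  have := sections_separate (rt' _ et1) (rt' _ et2) e12 (csec _ et1) (csec _ et2)
    (secx _ et1) (secx _ et2).
  by apply: filterS => y.
apply: filterS2 nD nsep => y; rewrite Dx => /lt_le_trans + sep; apply.
have [t2 [ut2 tw2]] := w_finite y.
rewrite /D -(big_map (fun e => sigma e y) xpredT (fun e => w y e * phi e)).
apply: (@seq_le_fsum _ _ _ _ t2).
- by move=> e; rewrite mulr_ge0.
- by move=> e; rewrite mulf_eq0 negb_or => /andP[/tw2].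
- by rewrite map_inj_in_uniq // => e1 e2 h1 h2; exact: sep.
Qed.

(** Mass 1 enters here: the constant [a] integrates to [a] at every [y], which lets a lower bound
    for [M - phi] serve as an upper bound for [phi]. *)
Let w_sum_affine y (a b : R) (phi : E -> R) :
  \sum_(e \in [set: E]) w y e * (a + b * phi e) =
  a + b * \sum_(e \in [set: E]) w y e * phi e.
Proof.
have [t [ut tw]] := w_finite y.
have h (g : E -> R) : \sum_(e \in [set: E]) w y e * g e = \sum_(e <- t) w y e * g e.
  by apply: fsum_seq => // e; rewrite mulf_eq0 negb_or => /andP[/tw].
rewrite !h mulr_sumr -[in RHS](mulr1 a) -(w_total y) (fsum_seq ut (tw)) mulr_sumr.
by rewrite -big_split /=; apply: eq_bigr => e _; ring.
Qed.

Let mu_continuous : continuous mu.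
Proof.
apply: (@continuous_comp_initial _ _ _ (@expectation R E n) mu).
move=> x; apply: ptws_continuous_at => phi; have [cphi [M phiM]] := svalP phi.
apply/cvgrPdist_lt => eps eps0.
have cM (b : R) : continuous (fun e => M + b * sval phi e).
  by move=> e; apply: cvgD; [exact: cvg_cst|apply: cvgM; [exact: cvg_cst|exact: cphi]].
have bd e : - M <= sval phi e <= M by rewrite -ler_norml.
have n1 : \forall y \near x, \sum_(e \in [set: E]) w x e * (M + 1 * sval phi e) - eps <
    \sum_(e \in [set: E]) w y e * (M + 1 * sval phi e).
  by apply: lower_semicontinuous => // e; have /andP[] := bd e; lra.
have n2 : \forall y \near x, \sum_(e \in [set: E]) w x e * (M + -1 * sval phi e) - eps <
    \sum_(e \in [set: E]) w y e * (M + -1 * sval phi e).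
  by apply: lower_semicontinuous => // e; have /andP[] := bd e; lra.
apply: filterS2 n1 n2 => y.
have affine z b := w_sum_affine z M b (sval phi).
rewrite (affine x 1) (affine x (-1)) (affine y 1) (affine y (-1)) => h1 h2.
suff : `|\sum_(e \in [set: E]) w x e * sval phi e -
    \sum_(e \in [set: E]) w y e * sval phi e| < eps by [].
move: (\sum_(e \in [set: E]) _) (\sum_(e \in [set: E]) w y e * _) h1 h2 => a b h1 h2.
by rewrite ltr_norml; apply/andP; split; lra.
Qed.

Lemma has_section_pullback : has_section R r n.
Proof.
have fib x : fiberwise r (mu x) by exists x => e /w_fiber[].
pose s' x : fiberwise (R := R) r (n := n) := exist _ (mu x) (mem_set (fib x)).
exists s'; split.
- apply: (@continuous_comp_initial _ B (nmeasure R E n) set_val s').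
  exact: mu_continuous.
- move=> x; rewrite /fiberwise_map; case: cid => b hb /=.
  (* Total mass 1 gives an atom, and any atom determines the base point that [fiberwise_map] selects
     by choice. *)
  have [e] : exists e, w x e != 0.
    apply: contrapT => nw; have := w_total x; rewrite fsbig1 => [/eqP|e _].
      by rewrite eq_sym oner_eq0.
    by apply: contrapT => h; apply: nw; exists e; apply/eqP.
  by move=> h; have <- := hb e h; have [->] := w_fiber h.
Qed.

End Pullback.

(** * Orbit spaces *)

Lemma trivialization_subset (E B : topologicalType) (q : E -> B) (U V : set B) sheet :
  V `<=` U -> trivialization q U sheet -> trivialization q V sheet.
Proof.
move=> VU tsh e Ve; have [h1 h2 h3] := tsh e (VU _ Ve).
by split => // y /VU; exact: h2.
Qed.

(* Paths inside the evenly covered set make moving to the point of the sheet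
   over [y0] commute with deck transformations; the sheets themselves need not
   be connected. *)
Lemma deck_trivialization (R : realType) (E B : topologicalType) (q : E -> B) (y0 : B) :
  covering_map q -> weakly_locally_path_connected R B ->
  exists V sheet, [/\ open V, V y0, trivialization q V sheet &
    forall h e, deck_transformation q h -> V (q e) ->
      sheet (h e) y0 = h (sheet e y0)].
Proof.
move=> covq wB; have [U [sh [oU Uy tsh]]] := covering_trivialization covq y0.
have nU : nbhs y0 U by exact: open_nbhs_nbhs.
pose N := [set y | exists g : unit_interval R -> B,
  [/\ continuous g, g zero = y0, g one = y & forall s, U (g s)]].
have nN : nbhs y0 N := wB _ _ nU.
have NU : N° `<=` U.
  by move=> y /interior_subset[g [_ _ <- Ug]].
exists N°, sh; split.
- exact: open_interior.
- exact: nN.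
- exact: trivialization_subset tsh.
- move=> h e dh Ve; have [g [cg g0 g1 Ug]] := interior_subset Ve.
  have Ue := NU _ Ve; have [she he _] := tsh _ Ue.
  have [qs _ _] := he _ Uy.
  have cl : continuous (fun s => sh e (g s)) by exact: (sheet_lift_continuous tsh).
  have [k [ch _ _ _ _]] := dh.
  have qh s : U (q (h (sh e (g s)))).
    by rewrite (deck_transformation_cover _ dh); have [-> _ _] := he _ (Ug s).
  (* The image under [h] of the lifted path from [sheet e y0] to [e] stays over [U], so it lies in a
     single sheet. *)
  have := sheet_connected tsh (@connected_unit_interval R) (comp_continuous cl ch) qh one zero.
  rewrite g1 g0 she => ->.
  have Uh := qh zero; rewrite g0 in Uh; have [k1 _ _] := tsh _ Uh.
  by rewrite -[RHS]k1 (deck_transformation_cover _ dh) qs.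
Qed.

Section OrbitSpaces.
Context (E X : topologicalType) (p : E -> X) (m : nat).

Lemma orbit_eqP (u v : {ptws 'I_m -> E}) :
  \pi_(orbit_space p m) u = \pi_(orbit_space p m) v <->
  exists2 g, deck_transformation p g & forall i, v i = g (u i).
Proof.
have e : \pi_(orbit_space p m) u = \pi_(orbit_space p m) v <->
    \pi_{eq_quot diagonal_equiv p m} u = \pi_{eq_quot diagonal_equiv p m} v by [].
rewrite e; split => [/eqmodP/asboolP //|h].
by apply/eqmodP/asboolP.
Qed.

Lemma orbit_local_section (e : orbit_space p m) : covering_map p ->
  exists sigma : {ptws 'I_m -> X} -> orbit_space p m,
  [/\ {for orbit_map e, continuous sigma}, sigma (orbit_map e) = e &
      \forall x \near (orbit_map e : {ptws 'I_m -> X}), orbit_map (sigma x) = x].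
Proof.
move=> covp; pose u : {ptws 'I_m -> E} := repr e.
have /choice[U /choice[sh shP]] : forall i, exists U sh,
    [/\ open U, U (p (u i)) & trivialization p U sh].
  by move=> i; exact: covering_trivialization.
pose lift (x : {ptws 'I_m -> X}) : {ptws 'I_m -> E} := fun i => sh i (u i) (x i).
exists (fun x => \pi_(orbit_space p m) (lift x)).
have clift : {for orbit_map e, continuous lift}.
  apply: ptws_continuous_at => i; have [_ Ui tsh] := shP i.
  have [_ /(_ _ Ui)[_ cs _] _] := tsh _ Ui.
  exact: continuous_comp (@ptws_eval_continuous _ _ i _) cs.
split.
- exact: continuous_comp clift (@pi_continuous _ _ _).
- rewrite -[RHS]reprK; congr (\pi_(orbit_space p m) _); apply/funext => i.
  by have [_ Ui tsh] := shP i; have [] := tsh _ Ui.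
- pose P (x : {ptws 'I_m -> X}) := forall i, U i (x i).
  have n : \forall x \near (orbit_map e : {ptws 'I_m -> X}), P x.
    apply: near_forall => i; have [oU Ui _] := shP i.
    exact: (@ptws_eval_continuous _ _ i _ _ (open_nbhs_nbhs (conj oU Ui))).
  apply: filterS n => x Ux; rewrite orbit_mapE; apply/funext => i.
  have [_ Ui tsh] := shP i.
  by have [_ /(_ _ (Ux i))[]] := tsh _ Ui.
Qed.

End OrbitSpaces.

(** A product of bumps on the base does not distinguish the points of a fibre, so it is cut off by
    [same_sheet]: moved over the base point of [e0], the tuple becomes a translate of [w] by one
    deck transformation. Compatibility of sheets with deck transformations makes this condition
    descend to orbits. *)
Lemma orbit_bump (R : realType) (E X : topologicalType) (p : E -> X) (m : nat)
    (cwX : cw_structure R X) (e0 : orbit_space p m) : covering_map p ->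
  exists psi : bounded_continuous R (orbit_space p m),
    sval psi e0 <> 0 /\ forall e1 e2, orbit_map e1 = orbit_map e2 ->
      sval psi e1 <> 0 -> sval psi e2 <> 0 -> e1 = e2.
Proof.
move=> covp; pose w : {ptws 'I_m -> E} := repr e0.
have wX := cw_weakly_locally_path_connected cwX.
have /choice[V /choice[sh shP]] := fun i => deck_trivialization (p (w i)) covp wX.
have /choice[b bP] : forall i, exists b : X -> R, [/\ continuous b, b (p (w i)) = 1,
    forall x, (~` V i) x -> b x = 0 & forall x, `|b x| <= 1].
  move=> i; have [oV Vi _ _] := shP i.
  by apply: (cw_bump cwX) => //; exact: open_closedC.
have cp := covering_continuous covp.
pose same_sheet (u : {ptws 'I_m -> E}) := (forall i, V i (p (u i))) /\
  exists2 h, deck_transformation p h & forall i, sh i (u i) (p (w i)) = h (w i).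
pose N (u : {ptws 'I_m -> E}) := \prod_(i < m) b i (p (u i)).
pose Psi u := if `[< same_sheet u >] then N u else 0.
have cN : continuous N.
  apply: continuous_big => [|i _]; first exact: mul_continuous.
  have [cb _ _ _] := bP i.
  exact: comp_continuous (comp_continuous (@ptws_eval_continuous _ _ i) cp) cb.
have N1 u : `|N u| <= 1.
  rewrite normr_prod; apply: prodr_ile1 => i _.
  by rewrite normr_ge0; have [_ _ _ ->] := bP i.
have PsiN u : `|Psi u| <= `|N u|.
  by rewrite /Psi; case: ifP => // _; rewrite normr0.
have same_sheet_deck u v g : deck_transformation p g -> (forall i, v i = g (u i)) ->
    same_sheet u -> same_sheet v.
  move=> dg vg [Vu [h dh hw]]; split.
    by move=> i; rewrite vg (deck_transformation_cover _ dg).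
  exists (g \o h); first exact: deck_transformation_comp.
  by move=> i; have [_ _ _ cm] := shP i; rewrite vg cm //= hw.
have Psi_deck u v : \pi_(orbit_space p m) u == \pi_(orbit_space p m) v -> Psi u == Psi v.
  move=> /eqP/orbit_eqP[g dg vg]; have [h dh gK] := deck_transformation_inv dg.
  have uh i : u i = h (v i) by rewrite vg gK.
  have Nuv : N u = N v.
    by apply: eq_bigr => i _; rewrite vg (deck_transformation_cover _ dg).
  have -> : Psi u = Psi v; last by [].
  rewrite /Psi Nuv; congr (if _ then _ else _).
  by apply/asboolP/asboolP; [exact: same_sheet_deck dg vg|exact: same_sheet_deck dh uh].
have cPsi : continuous Psi.
  move=> u; have [Vu|/existsNP[i nVi]] := pselect (forall i, V i (p (u i))).
    (* Sheets are locally constant over [V], so the cut-off condition does not change near [u]. *)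
    pose P (v : {ptws 'I_m -> E}) := forall i, V i (p (v i)) /\ sh i (v i) = sh i (u i).
    have n : \forall v \near u, P v.
      apply: near_forall => i; have [oV _ tsh _] := shP i.
      have nV := near_evenly_covered covp oV (Vu i); have [_ _ ns] := tsh _ (Vu i).
      exact: (@ptws_eval_continuous _ _ i _ _ (filterI nV ns)).
    have e v : P v -> Psi v = if `[< same_sheet u >] then N v else 0.
      move=> Pv; rewrite /Psi; congr (if _ then _ else _); apply/asbool_equiv_eq.
      split => -[_ [h dh hw]]; (split; first by move=> i; have [] := Pv i);
        by exists h => // i; rewrite -hw; have [_ ->] := Pv i.
    have cg : {for u, continuous (fun v => if `[< same_sheet u >] then N v else 0)}.
      by case: asbool; [exact: cN|exact: cst_continuous].
    move=> A; rewrite e; last by move=> i.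
    move=> /cg nA; have {}nA : \forall v \near u, A (if `[< same_sheet u >] then N v else 0).
      exact: nA.
    suff : \forall v \near u, A (Psi v) by [].
    by apply: filterS2 n nA => v /e ->.
  (* Here [same_sheet] may jump in every neighbourhood, but [N] vanishes at [u] and dominates
     [Psi]. *)
  have Nu : N u = 0.
    by rewrite /N (bigD1 i) //=; have [_ _ -> //] := bP i; rewrite mul0r.
  have Pu : Psi u = 0 by rewrite /Psi Nu if_same.
  apply/(@cvgrPdist_lt _ _ _ (nbhs u) _ Psi (Psi u)) => eps eps0.
  pose close (h : {ptws 'I_m -> E} -> R) v := `|h u - h v| < eps.
  have n : \forall v \near u, close N v.
    by have /(@cvgrPdist_lt _ _ _ (nbhs u) _ N (N u)) := cN u; apply.
  suff : \forall v \near u, close Psi v by [].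
  apply: filterS n => v; rewrite /close Nu Pu !sub0r !normrN.
  exact: le_lt_trans.
have cpsi := repr_comp_continuous cPsi Psi_deck.
pose psi : orbit_space p m -> R := Psi \o repr.
have bpsi : exists M, forall c, `|psi c| <= M.
  by exists 1 => c; exact: le_trans (PsiN _) (N1 _).
exists (exist _ psi (conj cpsi bpsi)); split => /=.
  rewrite /psi /= -/w /Psi ifT.
    rewrite /N big1 => [|i _]; first by apply/eqP; rewrite oner_eq0.
    by have [] := bP i.
  apply/asboolP; split; first by move=> i; have [] := shP i.
  exists id; first exact: deck_transformation_id.
  by move=> i; have [_ Vi tsh _] := shP i; have [] := tsh _ Vi.
move=> e1 e2 pe; rewrite /psi /= /Psi.
case: asboolP => // -[V1 [h dh hw]] _; case: asboolP => // -[V2 [k dk kw]] _.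
have [h' dh' hK] := deck_transformation_inv dh.
have dg := deck_transformation_comp dk dh'.
(* Over the base point of [e0] the two tuples become [h w] and [k w], so [k] after the inverse of
   [h] carries one to the other; equality of base points then brings this back along the sheets. *)
rewrite -[e1]reprK -[e2]reprK; apply/orbit_eqP; exists (k \o h') => // i.
have [_ Vi tsh cm] := shP i.
have pi12 : p (repr e1 i) = p (repr e2 i) := congr1 (fun x => x i) pe.
have Vg : V i (p ((k \o h') (repr e1 i))) by rewrite (deck_transformation_cover _ dg).
have s12 : sh i ((k \o h') (repr e1 i)) (p (w i)) = sh i (repr e2 i) (p (w i)).
  by rewrite cm // hw /= hK kw.
have [k1 k2 _] := tsh _ Vg; have [_ _ k3] := k2 _ Vi.
have [l1 l2 _] := tsh _ (V2 i); have [_ _ l3] := l2 _ Vi.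
by rewrite -k1 -l1 -k3 s12 l3 (deck_transformation_cover _ dg) pi12.
Qed.

(** * The map of orbit spaces induced by a lift *)

Section InducedOrbitMap.
Context (R : realType) (X Y Xt Yt : topologicalType) (f : continuousType X Y).
Context (p : Xt -> X) (q : Yt -> Y) (F : Xt -> Yt) (m : nat).
Hypotheses (ucp : universal_cover R p) (ucq : universal_cover R q).
Hypotheses (wXt : weakly_locally_path_connected R Xt).
Hypotheses (wYt : weakly_locally_path_connected R Yt).
Hypotheses (cF : continuous F) (qF : forall u, q (F u) = f (p u)).
Hypothesis pi1f : pi1_isomorphism R f.

Definition tuple_map (S T : Type) (h : S -> T) (u : {ptws 'I_m -> S}) : {ptws 'I_m -> T} :=
  fun i => h (u i).

Lemma tuple_map_continuous (S T : topologicalType) (h : S -> T) :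
  continuous h -> continuous (tuple_map h : {ptws 'I_m -> S} -> {ptws 'I_m -> T}).
Proof.
move=> ch u; apply: ptws_continuous_at => i.
exact: continuous_comp (@ptws_eval_continuous _ _ i u) (ch _).
Qed.

Definition induced_orbit_map (c : orbit_space p m) : orbit_space q m :=
  \pi_(orbit_space q m) (tuple_map F (repr c)).

Lemma induced_orbit_map_pi u :
  induced_orbit_map (\pi_(orbit_space p m) u) = \pi_(orbit_space q m) (tuple_map F u).
Proof.
have /orbit_eqP[g dg gu] : \pi_(orbit_space p m) u =
    \pi_(orbit_space p m) (repr (\pi_(orbit_space p m) u)) by rewrite reprK.
apply/esym/orbit_eqP; have [h dh hF] := lifted_map_deck ucp ucq cF qF wYt dg.
by exists h => // i; rewrite /tuple_map gu hF.
Qed.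

Lemma induced_orbit_map_continuous : continuous induced_orbit_map.
Proof.
apply: (@repr_comp_continuous _ _ _ (fun u => \pi_(orbit_space q m) (tuple_map F u))).
  by apply: comp_continuous (tuple_map_continuous cF) _; exact: pi_continuous.
by move=> u v /eqP uv; rewrite -!induced_orbit_map_pi uv.
Qed.

Lemma orbit_map_induced c : orbit_map (induced_orbit_map c) = tuple_map f (orbit_map c).
Proof. by rewrite /induced_orbit_map orbit_mapE; apply/funext => i; exact: qF. Qed.

(** The given [h] acts on [Yt], and a partner on [Xt] is needed. Coordinate [i0], available as [m]
    is positive, determines a candidate [g]; its image [h'] agrees with [h] at one point, hence
    everywhere. Injectivity of [F] on fibres then settles all the other coordinates. *)
Lemma induced_orbit_map_inj : (0 < m)%N -> forall c d,
  orbit_map c = orbit_map d -> induced_orbit_map c = induced_orbit_map d -> c = d.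
Proof.
move=> m0 c d pcd /orbit_eqP[h dh hF].
have pi i : p (repr c i) = p (repr d i) := congr1 (fun x => x i) pcd.
pose i0 := Ordinal m0.
have [g dg gi0] := deck_transformation_transitive ucp wXt (pi i0).
have [h' dh' h'F] := lifted_map_deck ucp ucq cF qF wYt dg.
have [covq scY] := ucq.
have [k [ch _ _ _ qh]] := dh; have [k' [ch' _ _ _ qh']] := dh'.
have hh' : forall y, h y = h' y.
  apply: (lift_unique covq (simply_connected_connected scY) ch ch' _
    (t0 := F (repr c i0))) => [y|].
    by rewrite (deck_transformation_cover _ dh) (deck_transformation_cover _ dh').
  by rewrite -h'F gi0 -hF.
rewrite -[c]reprK -[d]reprK; apply/orbit_eqP; exists g => // i.
apply: (lifted_map_fiber_inj ucp ucq cF qF pi1f).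
  by rewrite (deck_transformation_cover _ dg) pi.
by rewrite h'F -hh' -hF.
Qed.

Lemma induced_orbit_map_surj x d : orbit_map d = tuple_map f x ->
  exists2 c, orbit_map c = x & induced_orbit_map c = d.
Proof.
move=> qd; have [[_ surjp _] _] := ucp.
have /choice[u uP] : forall i, exists u, p u = x i /\ F u = repr d i.
  move=> i; have [u0 _ pu0] := surjp (x i) I.
  have qdi : q (repr d i) = f (p u0) by rewrite pu0; exact: (congr1 (fun y => y i) qd).
  have [u pu Fu] := lifted_map_fiber_surj ucp ucq cF qF pi1f qdi.
  by exists u; rewrite pu.
exists (\pi_(orbit_space p m) (u : {ptws 'I_m -> Xt})).
  by rewrite orbit_mapE; apply/funext => i; have [] := uP i.
rewrite induced_orbit_map_pi -[RHS]reprK; congr (\pi_(orbit_space q m) _).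
by apply/funext => i; have [] := uP i.
Qed.

End InducedOrbitMap.

(** * Comparison of the complexities *)

Lemma dsecat_le (R : realType) (E B E' B' : topologicalType) (r : E -> B) (r' : E' -> B') :
  (forall n, has_section R r' n -> has_section R r n) ->
  (dsecat R r <= dsecat R r')%E.
Proof.
move=> h; rewrite /dsecat.
case: (pselect (exists n, `[< has_section R r' n.+1 >])) => [h'|_]; last exact: leey.
case: pselect => [hr|[]].
  rewrite lee_fin ler_nat; case: ex_minnP => k _ kmin; case: ex_minnP => k' hk' _.
  by apply: kmin; apply/asboolP/h/asboolP.
by have [n /asboolP hn] := h'; exists n; apply/asboolP/h.
Qed.

Theorem proposition7p9 (R : realType) (X Y : topologicalType)
    (cwX : cw_structure R X) (cwY : cw_structure R Y)
    (connX : connected [set: X]) (connY : connected [set: Y])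
    (f : continuousType X Y) (pi1f : pi1_isomorphism R f)
    (Xt Yt : topologicalType) (p : Xt -> X) (q : Yt -> Y)
    (ucp : universal_cover R p) (ucq : universal_cover R q)
    (m : nat) (hm : (2 <= m)%N) :
  (diagonal_dTC R m p <= diagonal_dTC R m q)%E.
Proof.
have [covp scX] := ucp; have [covq scY] := ucq.
have wXt := cover_weakly_locally_path_connected covp (cw_weakly_locally_path_connected cwX).
have wYt := cover_weakly_locally_path_connected covq (cw_weakly_locally_path_connected cwY).
have cf : continuous f by exact: cts_fun.
have [[u0 _] _ _] := scX; have [_ surjq _] := covq.
have [v0 _ qv0] := surjq (f (p u0)) I.
(* The lift of [f \o p] through [q], started at an arbitrary point [v0] over [f (p u0)]. *)
have [F [cF qF _]] := lifting_exists covq scX wXt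
  (comp_continuous (covering_continuous covp) cf) qv0.
apply: dsecat_le => n [s [cs sK]].
apply: (has_section_pullback (Fb := @induced_orbit_map _ _ _ _ p q F m)
  (fb := @tuple_map m X Y f) _ _ _ _ _ _ _ cs sK).
- exact: induced_orbit_map_continuous ucp ucq wYt cF qF.
- exact: tuple_map_continuous.
- exact: orbit_map_induced.
- exact: (induced_orbit_map_inj ucp ucq wXt wYt cF qF pi1f (ltnW hm)).
- exact: (induced_orbit_map_surj ucp ucq wYt cF qF pi1f).
- by move=> e; exact: orbit_local_section.
- by move=> e; exact: (orbit_bump cwY).
Qed.
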